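(* Let $(D,G,\mathfrak h)$ be a quasi-triple. Then the dressing action of the quasi-Poisson Lie group $G_D^{\mathfrak h}$ on $S=D/G$, equipped with the bivector $P_S^{\mathfrak h}$, is a quasi-Poisson action; that is, $\frac12[P_S^{\mathfrak h},P_S^{\mathfrak h}]=(\varphi_{\mathfrak h})_S$ and $\mathcal L_{x_S}P_S^{\mathfrak h}=-F_{\mathfrak h}(x)_S$ for all $x\in\mathfrak g$.
   Context: Everything is real, finite-dimensional and smooth; ''bivector'' on a manifold means bivector field. $a\wedge b=a\otimes b-b\otimes a$. Manin pair $(\mathfrak d,\mathfrak g)$: a Lie algebra $\mathfrak d$ of dimension $2n$ with an invariant nondegenerate symmetric bilinear form $(\cdot|\cdot)$ of signature $(n,n)$, and a Lie subalgebra $\mathfrak g\subset\mathfrak d$ that is a maximal isotropic subspace. A group pair $(D,G)$: a connected Lie group $D$ with a bi-invariant scalar product and a connected closed Lie subgroup $G$ whose Lie algebras form a Manin pair $(\mathfrak d,\mathfrak g)$. A quasi-triple $(D,G,\mathfrak h)$ is a group pair with an isotropic linear complement $\mathfrak h$ of $\mathfrak g$ in $\mathfrak d$, $\mathfrak d=\mathfrak g\oplus\mathfrak h$ ($\mathfrak h$ need not be a subalgebra). $p_{\mathfrak g},p_{\mathfrak h}$ are the projections; $j:\mathfrak g^*\to\mathfrak h$ is the isomorphism with $(j(\xi)|x)=\langle\xi,x\rangle$. $F_{\mathfrak h}:\mathfrak g\to\bigwedge^2\mathfrak g$ is given by $F_{\mathfrak h}(x)(\xi,\eta)=\langle j^{-1}p_{\mathfrak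 h}[j\xi,j\eta],x\rangle$ and $\varphi_{\mathfrak h}\in\bigwedge^3\mathfrak g$ by $\varphi_{\mathfrak h}(\xi,\eta,\zeta)=\langle\zeta,p_{\mathfrak g}[j\xi,j\eta]\rangle$. With a basis $(e_i)$ of $\mathfrak g$ and dual basis $(\varepsilon^i)$ of $\mathfrak g^*$, $r_{\mathfrak d}=\sum_i e_i\otimes j(\varepsilon^i)\in\mathfrak d\otimes\mathfrak d$, and $P_D^{\mathfrak h}=r_{\mathfrak d}^\lambda-r_{\mathfrak d}^\rho$ (left- minus right-invariant tensor fields on $D$), which is a bivector. $G_D^{\mathfrak h}$ is $G$ with the restriction of $P_D^{\mathfrak h}$ to $G$ and with $\varphi_{\mathfrak h}$ (a quasi-Poisson Lie group). The dressing action is the action of $D$ (and of $G\subset D$) on $S=D/G$ induced by left multiplication. For $X\in\mathfrak d$, $X_S$ is the vector field $(X_Sf)(s)=\frac{d}{dt}f(\exp(-tX)s)|_{t=0}$; $X\mapsto X_S$ is extended multiplicatively to tensors and multivectors. $P_S^{\mathfrak h}$ is the projection of $P_D^{\mathfrak h}$ to $S$; equivalently $P_S^{\mathfrak h}=-\sum_i(e_i)_S\otimes(j\varepsilon^i)_S$. An action of $G_D^{\mathfrak h}$ on a manifold with bivector $(M,P_M)$ is quasi-Poisson if $\frac12[P_M,P_M]=(\varphi_{\mathfrak h})_M$ and $\mathcal L_{x_M}P_M=-F_{\mathfrak h}(x)_M$ for all $x\in\mathfrak g$. The Schouten bracket is normalized by $\frac12[P,P](df,dg,dh)=\{f,\{g,h\}\}+\{g,\{h,f\}\}+\{h,\{f,g\}\}$,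 where $\{f,g\}=P(df,dg)$. *)

(* Defs.v *)
From HB Require Import structures.
From mathcomp Require Import all_boot all_order all_algebra.
From mathcomp Require Import sesquilinear.
From mathcomp Require Import all_classical all_reals all_analysis.
Import Order.TTheory GRing.Theory Num.Theory.
Import numFieldNormedType.Exports.

Set Implicit Arguments.
Unset Strict Implicit.
Unset Printing Implicit Defensive.

Local Open Scope classical_set_scope.
Local Open Scope ring_scope.

Section SmoothMaps.
Context {R : realType} {V W : normedModType R}.

Fixpoint differentiable_upto (k : nat) (U : set V) (f : V -> W) : Prop :=
  if k is k'.+1 then
    (forall x, U x -> differentiable f x) /\
    (forall v, differentiable_upto k' U ('D_v f))
  else True.

(* On an open set U of a finite-dimensional space this is C^oo on U: a k+1 times
   differentiable function is of class C^k. *)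
Definition smooth_on (U : set V) (f : V -> W) : Prop :=
  forall k, differentiable_upto k U f.

End SmoothMaps.

(* [coordinates] and [parametrization] are total functions; they only matter on
   [domain] and on its image. *)
Record chart (R : realType) (n : nat) (M : topologicalType) := Chart {
  domain : set M;
  coordinates : M -> 'rV[R]_n;
  parametrization : 'rV[R]_n -> M;
  domain_open : open domain;
  image_open : open (coordinates @` domain);
  chartK : forall x, domain x -> parametrization (coordinates x) = x;
  coordinates_continuous : {within domain, continuous coordinates};
  parametrization_continuous :
    {within coordinates @` domain, continuous parametrization}
}.

Definition chart_compatible (R : realType) (n : nat) (M : topologicalType)
    (a b : chart R n M) : Prop :=
  smooth_on (coordinates a @` (domain a `&` domain b))
    (coordinates b \o parametrization a).

HB.mixin Record Topological_isManifold (R : realType) (n : nat) M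
    of Topological M := {
  atlas : set (chart R n M);
  atlas_cover : forall x : M, exists2 a, atlas a & domain a x;
  atlas_compatible :
    forall a b, atlas a -> atlas b -> chart_compatible a b;
  manifold_hausdorff : hausdorff_space M;
  manifold_second_countable : @second_countable M
}.

#[short(type="manifoldType")]
HB.structure Definition Manifold (R : realType) (n : nat) :=
  { M of Topological_isManifold R n M & Topological M }.

Definition smooth_map {R : realType} {m n : nat}
    {M : manifoldType R m} {N : manifoldType R n} (F : M -> N) : Prop :=
  continuous F /\
  forall (a : chart R m M) (b : chart R n N), atlas a -> atlas b ->
    smooth_on (coordinates a @` (domain a `&` F @^-1` domain b))
      (coordinates b \o F \o parametrization a).

(* Smoothness of a map on the product manifold M * N, in product charts. *)
Definition smooth_map2 {R : realType} {m n p : nat} {M : manifoldType R m}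
    {N : manifoldType R n} {Q : manifoldType R p} (F : M * N -> Q) : Prop :=
  continuous F /\
  forall (a : chart R m M) (b : chart R n N) (c : chart R p Q),
    atlas a -> atlas b -> atlas c ->
    smooth_on
      [set (coordinates a xy.1, coordinates b xy.2) | xy in
         (domain a `*` domain b) `&` F @^-1` domain c]
      (fun uv : 'rV[R]_m * 'rV[R]_n =>
         coordinates c (F (parametrization a uv.1, parametrization b uv.2))).

Definition smooth_functions {R : realType} {n : nat} (M : manifoldType R n) :
    set (M -> R) :=
  [set f : M -> R | forall a : chart R n M, atlas a ->
     smooth_on (coordinates a @` domain a) (f \o parametrization a)].
Arguments smooth_functions {R n} M _.

(* A manifold M enters only through its algebra C of smooth functions: a vector
   field is a derivation of C, and a bivector field P is the skew biderivation
   (f, g) |-> P(df, dg). Only the values on C are relevant. *)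

Section Fields.
Context {R : realType} {M : Type}.
Variable C : set (M -> R).

Record is_vector_field (X : (M -> R) -> M -> R) : Prop := IsVectorField {
  vf_smooth : forall f, C f -> C (X f);
  vf_linear : forall (a : R) f g, C f -> C g ->
    X (fun x => a * f x + g x) = (fun x => a * X f x + X g x);
  vf_leibniz : forall f g, C f -> C g ->
    X (fun x => f x * g x) = (fun x => X f x * g x + f x * X g x)
}.

Record is_bivector_field (P : (M -> R) -> (M -> R) -> M -> R) : Prop :=
  IsBivectorField {
  bv_skew : forall f g, C f -> C g -> P f g = (fun x => - P g f x);
  bv_derivation : forall f, C f -> is_vector_field (P f)
}.

(* [P, P](df, dg, dh) *)
Definition schouten_square (P : (M -> R) -> (M -> R) -> M -> R)
    (f g h : M -> R) (x : M) : R :=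
  2 * (P f (P g h) x + P g (P h f) x + P h (P f g) x).

(* (L_X P)(df, dg) *)
Definition lie_derivative (X : (M -> R) -> M -> R)
    (P : (M -> R) -> (M -> R) -> M -> R) (f g : M -> R) (x : M) : R :=
  X (P f g) x - P (X f) g x - P f (X g) x.

End Fields.

HB.mixin Record Manifold_isLieGroup (R : realType) (n : nat) D
    of Manifold R n D & Group D := {
  mul_smooth : smooth_map2 (fun xy : D * D => (xy.1 * xy.2)%g);
  inv_smooth : smooth_map (fun x : D => (x^-1)%g)
}.

#[short(type="lieGroupType")]
HB.structure Definition LieGroup (R : realType) (n : nat) :=
  { D of Manifold_isLieGroup R n D & Manifold R n D & Group D }.

Section LieAlgebra.
Context {R : realType} {n : nat}.
Variable D : lieGroupType R n.

Local Notation Coo := (smooth_functions D).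

Definition left_invariant_field (X : (D -> R) -> D -> R) : Prop :=
  is_vector_field Coo X /\
  forall f, Coo f -> forall a x, X f (a * x)%g = X (fun y => f (a * y)%g) x.

(* The Lie algebra of D: a vector space identified by X |-> X^lambda with the
   left-invariant vector fields under the commutator, with its exponential map;
   t |-> exp (t X) is the integral curve of X^lambda through 1. *)
Record lieAlgebra := LieAlgebra {
  lie_space :> vectType R;
  lambda : lie_space -> (D -> R) -> D -> R;
  bracket : lie_space -> lie_space -> lie_space;
  expo : lie_space -> D;
  lambda_left_invariant : forall X, left_invariant_field (lambda X);
  lambda_linear : forall (a : R) X Y f, Coo f ->
    lambda (a *: X + Y) f = (fun d => a * lambda X f d + lambda Y f d);
  lambda_bijective : forall Z, left_invariant_field Z ->
    exists! X, forall f, Coo f -> lambda X f = Z f;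
  lambda_bracket : forall X Y f, Coo f ->
    lambda (bracket X Y) f =
      (fun d => lambda X (lambda Y f) d - lambda Y (lambda X f) d);
  expo0 : expo 0 = 1%g;
  expo_flow : forall X f (t : R), Coo f ->
    is_derive t 1 (fun s : R => f (expo (s *: X))) (lambda X f (expo (t *: X)))
}.

End LieAlgebra.

Section LieAlgebraTheory.
Context {R : realType} {n : nat} {D : lieGroupType R n}.
Variable L : lieAlgebra D.

(* X^rho: the right-invariant vector field with value X at 1. *)
Definition rho (X : L) (f : D -> R) (d : D) : R :=
  lambda X (fun y => f (y * d)%g) 1%g.

(* Y = Ad_d X: the tangent map at 1 of y |-> d y d^-1 sends X to Y. *)
Definition is_Ad (d : D) (X Y : L) : Prop :=
  forall f, smooth_functions D f ->
    lambda Y f 1%g = lambda X (fun y => f (d * y * d^-1)%g) 1%g.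

End LieAlgebraTheory.

Section QuasiTriple.
Context {R : realType} {n : nat} {D : lieGroupType R n.*2}.
Variable L : lieAlgebra D.
Variable B : {symmetric L}.

Definition isotropic (U : {vspace L}) : Prop :=
  forall X Y, X \in U -> Y \in U -> B X Y = 0.

Definition signature_nn : Prop :=
  exists u v : n.-tuple L,
    [/\ basis_of fullv (u ++ v),
        forall i j : 'I_n, B (tnth u i) (tnth u j) = (i == j)%:R,
        forall i j : 'I_n, B (tnth v i) (tnth v j) = - (i == j)%:R &
        forall i j : 'I_n, B (tnth u i) (tnth v j) = 0].

Record is_manin_pair (g : {vspace L}) : Prop := IsManinPair {
  manin_dim : \dim {:L} = n.*2;
  manin_invariant : forall X Y Z : L, B (bracket X Y) Z = B X (bracket Y Z);
  manin_nondegenerate : nondegenerate B;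
  manin_signature : signature_nn;
  manin_subalgebra : forall X Y, X \in g -> Y \in g -> bracket X Y \in g;
  manin_isotropic : isotropic g;
  manin_maximal :
    forall U : {vspace L}, (g <= U)%VS -> isotropic U -> U = g
}.

(* The scalar product on D is the left-invariant metric with value B at 1; it is
   also right-invariant if and only if B is Ad-invariant. *)
Record is_group_pair (G : set D) (g : {vspace L}) : Prop := IsGroupPair {
  group_connected : connected [set: D];
  group_biinvariant : forall d X X' Y Y',
    is_Ad d X X' -> is_Ad d Y Y' -> B X' Y' = B X Y;
  subgroup_one : G 1%g;
  subgroup_mul : forall x y, G x -> G y -> G (x * y)%g;
  subgroup_inv : forall x, G x -> G (x^-1)%g;
  subgroup_closed : closed G;
  subgroup_connected : connected G;
  subgroup_lie_algebra : forall X : L,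
    X \in g <-> (forall t : R, G (expo (t *: X)));
  group_manin_pair : is_manin_pair g
}.

Record is_quasi_triple (G : set D) (g h : {vspace L}) : Prop :=
  IsQuasiTriple {
  quasi_triple_group_pair : is_group_pair G g;
  quasi_triple_isotropic : isotropic h;
  quasi_triple_direct : (g :&: h)%VS = 0%VS;
  quasi_triple_sum : (g + h)%VS = fullv
}.

End QuasiTriple.

Section Tensors.
Context {R : realType} {n : nat} {D : lieGroupType R n.*2} {L : lieAlgebra D}.
Variables (B : {symmetric L}) (g h : {vspace L}).

Definition dual := 'Hom(subvs_of g, R^o).

Definition p_g : 'End(L) := daddv_pi g h.
Definition p_h : 'End(L) := daddv_pi h g.

(* y |-> (y | .), which is the inverse of j. *)
Definition j_inv : 'Hom(subvs_of h, dual) :=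
  linfun (fun y : subvs_of h =>
    linfun (fun x : subvs_of g => B (vsval y) (vsval x) : R^o) : dual).

Definition j (xi : dual) : L := vsval ((j_inv^-1)%VF xi).

(* Elements of the exterior powers of g, as multilinear forms on the dual. *)
Definition F_tensor (x : subvs_of g) (xi eta : dual) : R :=
  j_inv (vsproj h (p_h (bracket (j xi) (j eta)))) x.

Definition phi_tensor (xi eta zeta : dual) : R :=
  zeta (vsproj g (p_g (bracket (j xi) (j eta)))).

Variable e : (\dim g).-tuple L.

Definition dual_basis (i : 'I_(\dim g)) : dual :=
  linfun (fun x : subvs_of g => coord e i (vsval x) : R^o).

(* P_D(df, dg) for P_D = r^lambda - r^rho, r = sum_i e_i (x) j(eps^i). *)
Definition P_D (f k : D -> R) (d : D) : R :=
  \sum_i lambda (tnth e i) f d * lambda (j (dual_basis i)) k d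
  - \sum_i rho (tnth e i) f d * rho (j (dual_basis i)) k d.

End Tensors.

Section Actions.
Context {R : realType} {n : nat} {D : lieGroupType R n.*2} {L : lieAlgebra D}.

(* An action of the subgroup G of D; the values outside G are irrelevant. *)
Record left_action (G : set D) (M : Type) := LeftAction {
  action_fun :> D -> M -> M;
  action1 : forall m, action_fun 1%g m = m;
  actionM : forall a b m, G a -> G b ->
    action_fun (a * b)%g m = action_fun a (action_fun b m)
}.

Context {G : set D} {M : Type}.
Variables (g h : {vspace L}) (act : left_action G M).

(* X_M f = d/dt f(exp(- t X) m) at t = 0; for X in g the group element lies in G. *)
Definition fundamental_field (X : L) (f : M -> R) (m : M) : R :=
  derive1 (fun t : R => f (act (expo (- t *: X)) m)) 0.

Variable e : (\dim g).-tuple L.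

(* T_M for a tensor T on g, given by its components in the basis e. *)
Definition fundamental_tensor2 (T : dual g -> dual g -> R)
    (f k : M -> R) (m : M) : R :=
  \sum_i1 \sum_i2 T (dual_basis e i1) (dual_basis e i2)
    * fundamental_field (tnth e i1) f m * fundamental_field (tnth e i2) k m.

Definition fundamental_tensor3 (T : dual g -> dual g -> dual g -> R)
    (f k l : M -> R) (m : M) : R :=
  \sum_i1 \sum_i2 \sum_i3
    T (dual_basis e i1) (dual_basis e i2) (dual_basis e i3)
    * fundamental_field (tnth e i1) f m * fundamental_field (tnth e i2) k m
    * fundamental_field (tnth e i3) l m.

Record is_quasi_poisson_action (B : {symmetric L}) (C : set (M -> R))
    (P : (M -> R) -> (M -> R) -> M -> R) : Prop := IsQuasiPoissonAction {
  qp_bivector : is_bivector_field C P;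
  qp_schouten : forall f k l, C f -> C k -> C l -> forall m,
    2^-1 * schouten_square P f k l m
    = fundamental_tensor3 (phi_tensor B h) f k l m;
  qp_lie_derivative : forall (x : subvs_of g) f k, C f -> C k -> forall m,
    lie_derivative (fundamental_field (vsval x)) P f k m
    = - fundamental_tensor2 (F_tensor B h x) f k m
}.

End Actions.

Section Dressing.
Context {R : realType} {n : nat} {D : lieGroupType R n.*2}.
Variable G : set D.

Definition left_coset (d : D) : set D := [set (d * x)%g | x in G].

Definition coset_space := {A : set D | exists d, A = left_coset d}.

Definition coset_proj (d : D) : coset_space :=
  exist _ (left_coset d) (ex_intro _ d erefl).

(* The manifold structure of D / G is the unique one for which the projection is
   a submersion; its smooth functions are those with smooth pull-back to D. *)
Definition smooth_functions_quotient : set (coset_space -> R) :=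
  [set f : coset_space -> R | smooth_functions D (f \o coset_proj)].

Lemma dressing_subproof (a : D) (s : coset_space) :
  exists d, [set (a * x)%g | x in sval s] = left_coset d.
Proof.
case: s => A [d Ad] /=; exists (a * d)%g; rewrite Ad.
apply/seteqP; split=> [_ [_ [x Gx <-] <-]|_ [x Gx <-]].
  by exists x => //; rewrite mulgA.
by exists (d * x)%g; [exists x | rewrite mulgA].
Qed.

Definition dressing_fun (a : D) (s : coset_space) : coset_space :=
  exist _ [set (a * x)%g | x in sval s] (dressing_subproof a s).

Lemma dressing1 s : dressing_fun 1%g s = s.
Proof.
apply: eq_sig_hprop => [A|/=]; first exact: Prop_irrelevance.
apply/seteqP; split=> [_ [x sx <-]|x sx].
  by rewrite mul1g.
by exists x => //; rewrite mul1g.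
Qed.

Lemma dressingM a b s : G a -> G b ->
  dressing_fun (a * b)%g s = dressing_fun a (dressing_fun b s).
Proof.
move=> _ _; apply: eq_sig_hprop => [A|/=]; first exact: Prop_irrelevance.
apply/seteqP; split=> [_ [x sx <-]|_ [_ [x sx <-] <-]].
  by exists (b * x)%g; [exists x | rewrite mulgA].
by exists x => //; rewrite mulgA.
Qed.

Definition dressing : left_action G coset_space :=
  LeftAction dressing1 dressingM.

Definition coset_repr (s : coset_space) : D := projT1 (cid (svalP s)).

(* The projection to D / G of a bivector field on D. It does not depend on the
   chosen representatives when [projects_to] below holds. *)
Definition proj_bivector (P : (D -> R) -> (D -> R) -> D -> R)
    (f k : coset_space -> R) (s : coset_space) : R :=
  P (f \o coset_proj) (k \o coset_proj) (coset_repr s).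

Definition projects_to (P : (D -> R) -> (D -> R) -> D -> R)
    (Q : (coset_space -> R) -> (coset_space -> R) -> coset_space -> R) : Prop :=
  forall f k, smooth_functions_quotient f -> smooth_functions_quotient k ->
    Q f k \o coset_proj = P (f \o coset_proj) (k \o coset_proj).

End Dressing.

Arguments smooth_functions_quotient {R n D} G _.

(* Main.v *)
From HB Require Import structures.
Require Import Defs.
From mathcomp Require Import all_boot all_order all_algebra.
From mathcomp Require Import sesquilinear.
From mathcomp Require Import all_classical all_reals all_analysis.
From mathcomp Require Import lra ring.
Import Order.TTheory GRing.Theory Num.Theory.
Import numFieldNormedType.Exports.

Local Open Scope classical_set_scope.
Local Open Scope ring_scope.

(** On functions pulled back from S = D/G the left-invariant fields of elements
    of g vanish, and X_S lifts to - X^rho.  Hence P_S = - sum_i x_i (x) y_i with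
    x_i = (e_i)_S and y_i = (j eps^i)_S, where (e_i), (j eps^i) is a hyperbolic
    basis of d and X |-> X_S is a Lie algebra morphism.  The symmetric part
    sum_i (x_i (x) y_i + y_i (x) x_i) vanishes: it is the image of the tensor
    dual to the scalar product, and the kernel Ad_a g of X |-> X_S(a G) is
    Lagrangian.  This gives skewness, and it removes the second order terms from
    the Jacobiator of P_S; what remains consists of brackets of the x_i and y_i,
    whose expansions in the hyperbolic basis cancel except for phi_h.

    The analytic input is that X^rho is smooth and X |-> - X^rho preserves
    brackets.  Both follow from X^rho = - inv^* X^lambda inv^*, that is, from
    differentiating exp(tX) exp(tX)^-1 = 1 in charts; the differentiability of
    t |-> exp(tX) in charts is obtained from bump functions. *)

Set Implicit Arguments.
Unset Strict Implicit.
Unset Printing Implicit Defensive.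

(** * Calculus of k times differentiable maps between normed spaces *)

Section DifferentiableUpto.
Context {R : realType}.
Implicit Types V W : normedModType R.

(** The difference [g - f] vanishes near x, so its differential there is the zero map; g is then a
    sum of two differentiable maps. *)
Lemma near_eq_differentiable V W (f g : V -> W) x :
  (\near x, f x = g x) -> differentiable f x -> differentiable g x.
Proof.
move=> fg df.
have dgf : differentiable (g \- f) x.
  suff [] : is_diff x (g \- f) 0 by [].
  have e : (g \- f) \o shift x = cst ((g \- f) x) + 0 +o_ 0 id.
    have fgx : f x = g x by exact: (nbhs_singleton fg).
    apply/eqaddoP => _/posnumP[eps].
    rewrite [\forall x \near _, _ <= _](near_shift x) sub0r; near=> y.
    rewrite /= !fctE /= subrK (_ : f y = g y); last by near: y.
    rewrite fgx !subrr addr0 subrr normr0.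
    by rewrite mulr_ge0.
  have c0 : continuous (\0 : V -> W) by move=> y; exact: cvg_cst.
  have d0 : 'd (g \- f) x = \0 :> (V -> W) by exact: (diff_unique c0 e).
  apply: DiffDef => //; apply/diff_locallyP; rewrite d0; split=> //.
rewrite (_ : g = f \+ (g \- f)); first exact: differentiableD.
by apply/funext => y /=; rewrite addrC subrK.
Unshelve. all: by end_near. Qed.

(** Openness of [U] turns equality on [U] into equality near each point, which passes to directional
    derivatives. *)
Lemma differentiable_upto_eq V W k (U : set V) (f g : V -> W) : open U ->
  (forall x, U x -> f x = g x) ->
  differentiable_upto k U f -> differentiable_upto k U g.
Proof.
move=> oU; elim: k f g => //= k IH f g fg [df ddf].
have fgn x : U x -> \near x, f x = g x.
  by move=> Ux; near=> y; apply: fg; near: y; exact: open_nbhs_nbhs.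
split=> [x Ux|v]; first exact: near_eq_differentiable (fgn _ Ux) (df _ Ux).
apply: (IH _ _ _ (ddf v)) => x Ux.
exact/near_eq_derive/fgn.
Unshelve. all: by end_near. Qed.

(** The derivatives are those of the total function and are only inspected at points of [U], so the
    condition is pointwise and makes sense even on a singleton. *)
Lemma differentiable_upto_local V W k (U : set V) (f : V -> W) :
  (forall x, U x -> differentiable_upto k [set x] f) -> differentiable_upto k U f.
Proof.
elim: k f => //= k IH f Uf; split=> [x /Uf[/(_ x erefl)]//|v].
by apply: IH => x /Uf[_ /(_ v)].
Qed.

Lemma differentiable_upto_sub V W k (U O : set V) (f : V -> W) :
  U `<=` O -> differentiable_upto k O f -> differentiable_upto k U f.
Proof.
move=> UO; elim: k f => //= k IH f [df ddf]; split=> [x /UO/df//|v].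
exact: IH.
Qed.

Lemma differentiable_uptoW V W k (U : set V) (f : V -> W) :
  differentiable_upto k.+1 U f -> differentiable_upto k U f.
Proof.
elim: k f => //= k IH f [df ddf]; split=> // v; exact/IH/ddf.
Qed.

Lemma differentiable_upto_cst V W k (U : set V) (c : W) :
  differentiable_upto k U (fun _ : V => c).
Proof.
elim: k c => //= k IH c; split=> [x _|v]; first exact: differentiable_cst.
by rewrite (_ : 'D_v _ = fun=> 0)//; apply/funext => x; rewrite derive_cst.
Qed.

Lemma differentiable_upto_id V k (U : set V) : differentiable_upto k U id.
Proof.
case: k => //= k; split=> // v.
rewrite (_ : 'D_v id = fun=> v); first exact: differentiable_upto_cst.
by apply/funext => x; rewrite derive_id.
Qed.

Lemma differentiable_uptoD V W k (U : set V) (f g : V -> W) : open U ->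
  differentiable_upto k U f -> differentiable_upto k U g ->
  differentiable_upto k U (fun x => f x + g x).
Proof.
move=> oU; elim: k f g => //= k IH f g [df ddf] [dg ddg]; split=> [x Ux|v].
  exact: differentiableD (df _ Ux) (dg _ Ux).
apply: (differentiable_upto_eq oU _ (IH _ _ (ddf v) (ddg v))) => x Ux.
 apply/esym/deriveD; apply: diff_derivable; [exact: df|exact: dg].
Qed.

Lemma differentiable_upto_sum V W k (U : set V) (I : finType) (f : I -> V -> W) :
  open U -> (forall i, differentiable_upto k U (f i)) ->
  differentiable_upto k U (fun x => \sum_i f i x).
Proof.
move=> oU Uf; elim: (index_enum I) => [|i s IH].
  rewrite (_ : (fun _ => _) = fun=> 0); first exact: differentiable_upto_cst.
  by apply/funext => x; rewrite big_nil.
rewrite (_ : (fun _ => _) = fun x => f i x + \sum_(i <- s) f i x).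
  exact: differentiable_uptoD.
by apply/funext => x; rewrite big_cons.
Qed.

Lemma differentiable_uptoM V k (U : set V) (f g : V -> R) : open U ->
  differentiable_upto k U f -> differentiable_upto k U g ->
  differentiable_upto k U (fun x => f x * g x).
Proof.
move=> oU; elim: k f g => // k IH f g kf kg; have [df ddf] := kf.
have [dg ddg] := kg; split=> [x Ux|v].
  exact: differentiableM (df _ Ux) (dg _ Ux).
pose u x := f x * 'D_v g x + g x * 'D_v f x.
apply: (@differentiable_upto_eq _ _ _ _ u) => //.
  move=> x Ux; apply/esym/deriveM; apply: diff_derivable.
    exact: df.
  exact: dg.
apply: differentiable_uptoD => //.
  by apply: IH; [exact: differentiable_uptoW|exact: ddg].
by apply: IH; [exact: differentiable_uptoW|exact: ddf].
Qed.

Lemma differentiable_upto_prod V k (U : set V) (I : finType) (f : I -> V -> R) :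
  open U -> (forall i, differentiable_upto k U (f i)) ->
  differentiable_upto k U (fun x => \prod_i f i x).
Proof.
move=> oU Uf; elim: (index_enum I) => [|i s IH].
  rewrite (_ : (fun _ => _) = fun=> 1); first exact: differentiable_upto_cst.
  by apply/funext => x; rewrite big_nil.
rewrite (_ : (fun _ => _) = fun x => f i x * \prod_(i <- s) f i x).
  exact: differentiable_uptoM.
by apply/funext => x; rewrite big_cons.
Qed.

Lemma differentiable_upto_coord V m k (U : set V) (f : V -> 'rV[R]_m) i :
  open U -> differentiable_upto k U f ->
  differentiable_upto k U (fun x => f x 0 i : R).
Proof.
move=> oU; elim: k f => // k IH f [df ddf]; split=> [x Ux|v].
  have /= := differentiable_comp (df _ Ux) (differentiable_coord (f x) 0 i).
  exact.
apply: differentiable_upto_eq (IH _ (ddf v)) => //.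
move=> x Ux.
by rewrite derive_mx ?mxE//; exact/diff_derivable/df.
Qed.

Lemma derive_comp_rV V m (f : V -> 'rV[R]_m) (g : 'rV[R]_m -> R) x v :
  differentiable f x -> differentiable g (f x) ->
  'D_v (g \o f) x = \sum_i ('D_v f x) 0 i * 'D_(delta_mx 0 i) g (f x).
Proof.
move=> df dg; rewrite deriveE; last exact: differentiable_comp.
rewrite diff_comp//= -(deriveE v df).
transitivity ('d g (f x) (\sum_i ('D_v f x) 0 i *: delta_mx 0 i)).
  by rewrite -row_sum_delta.
rewrite linear_sum; by apply: eq_bigr => i _; rewrite linearZ/= -deriveE.
Qed.

(** Expanded in coordinates, the chain rule gives a sum of products whose factors are coordinates of
    ['D_v f] and compositions of partial derivatives of g with the same f, so the induction
    closes. *)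
Lemma differentiable_upto_comp V m k (U : set V) (O : set 'rV[R]_m)
    (f : V -> 'rV[R]_m) (g : 'rV[R]_m -> R) : open U -> open O ->
  (forall x, U x -> O (f x)) -> differentiable_upto k U f ->
  differentiable_upto k O g -> differentiable_upto k U (g \o f).
Proof.
move=> oU oO UO; elim: k f g UO => // k IH f g UO kf kg; have [df ddf] := kf.
have [dg ddg] := kg; split=> [x Ux|v].
  by apply: differentiable_comp; [exact: df|apply: dg; exact: UO].
pose u x := \sum_i ('D_v f x) 0 i * ('D_(delta_mx 0 i) g \o f) x.
apply: (@differentiable_upto_eq _ _ _ _ u) => //.
  move=> x Ux; apply/esym/derive_comp_rV; [exact: df|apply: dg; exact: UO].
apply: differentiable_upto_sum => // i; apply: differentiable_uptoM => //.
  exact: (differentiable_upto_coord i oU (ddf v)).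
by apply: IH => //; [exact: differentiable_uptoW|exact: ddg].
Qed.

(** The derivative of the slice along v is the slice of the derivative along (v, 0), with the same
    difference quotients. *)
Lemma differentiable_upto_slice V1 V2 W k (O : set (V1 * V2)%type)
    (f : V1 * V2 -> W) y :
  differentiable_upto k O f ->
  differentiable_upto k [set x | O (x, y)] (fun x => f (x, y)).
Proof.
elim: k f => // k IH f [df ddf]; split=> [x Ox|v].
  apply: (@differentiable_comp _ _ _ _ (fun x => (x, y)) f); last exact: df.
  exact: differentiable_pair.
rewrite (_ : 'D_v _ = fun x => 'D_(v, 0) f (x, y)); first exact: (IH _ (ddf (v, 0))).
apply/funext => x; rewrite /derive.
suff -> : (fun t => t^-1 *: (((fun x => f (x, y)) \o shift x) (t *: v) - f (x, y)))
  = (fun t => t^-1 *: ((f \o shift (x, y)) (t *: (v, 0)) - f (x, y))) by [].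
apply/funext => t /=.
by congr (_ *: (f (_, _) - _)); rewrite /= scaler0 add0r.
Qed.

End DifferentiableUpto.

(** * Bump functions on R^m *)

Section Bump.
Context {R : realType}.

(* The derivative of x^-k exp(-1/x) is a combination of functions of the same
   family. *)
Definition flat (k : nat) (x : R) : R :=
  if 0 < x then x ^- k * expR (- x^-1) else 0.

Lemma flat_gt0 k x : 0 < x -> 0 < flat k x.
Proof. by move=> x0; rewrite /flat x0 mulr_gt0 ?expR_gt0// invr_gt0 exprn_gt0. Qed.

Lemma flat_le0 k x : x <= 0 -> flat k x = 0.
Proof. by rewrite /flat leNgt => /negbTE ->. Qed.

Lemma flat_ge0 k x : 0 <= flat k x.
Proof.
by have [x0|x0] := ltP 0 x; [exact/ltW/flat_gt0|rewrite flat_le0].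
Qed.

(** This is exp(y) >= y^(k+1) / (k+1)! at y = 1/x. *)
Lemma flat_le k x : 0 < x -> flat k x <= k.+1`!%:R * x.
Proof.
move=> x0; rewrite /flat x0 expRN.
have xV0 : 0 <= x^-1 by rewrite invr_ge0 ltW.
have y0 : 0 < x^-1 ^+ k.+1 / k.+1`!%:R.
  by rewrite divr_gt0 ?ltr0n ?fact_gt0// exprn_gt0// invr_gt0.
have : x^-1 ^+ k.+1 / k.+1`!%:R <= expR x^-1.
  by apply: le_trans (expR_ge1Dxn k xV0); rewrite lerDr.
rewrite -lef_pV2 ?posrE ?expR_gt0// => le1.
apply: le_trans (ler_wpM2l _ le1) _; first by rewrite invr_ge0 exprn_ge0// ltW.
rewrite invf_div exprVn invrK exprS mulrCA; apply: ler_wpM2l.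
  by rewrite ler0n.
by rewrite mulrCA mulVf ?mulr1// expf_eq0 gt_eqF ?andbF.
Qed.

Lemma is_derive_flat k (x : R) :
  is_derive x 1 (flat k) (flat k.+2 x - k%:R * flat k.+1 x).
Proof.
have [x0|x0|->] := ltgtP x 0.
- rewrite !flat_le0 ?ltW// mulr0 subr0.
  apply: (@near_eq_is_derive _ _ _ (cst (0 : R))).
    by near=> y; rewrite flat_le0// ltW//; near: y; exact: lt_nbhsl.
- apply: (@near_eq_is_derive _ _ _ (fun y : R => y ^- k * expR (- y^-1))).
    near=> y; rewrite /flat ifT//; near: y; exact: lt_nbhsr.
  have x1 : x != 0 by rewrite gt_eqF.
  have dV := is_deriveV x1 (is_derive_id x (1 : R)).
  have dk := is_deriveX k dV.
  have dE := is_derive1_comp (is_derive_expR _) (is_deriveN dV).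
  have dM := is_deriveM dk dE.
  rewrite (_ : (fun _ => _) = (fun y => y^-1) ^+ k * (expR \o (- (fun y => y^-1)))).
    apply: is_derive_eq dM _.
    rewrite /flat x0 !exprfctE /=.
    rewrite -!exprVn /GRing.scale/= !mulr1; set E := expR _.
    case: k {dk} => [|k]; rewrite ?exprS ?expr0; ring.
  by apply/funext => y; rewrite -exprVn exprfctE.
- rewrite !flat_le0// mulr0 subr0.
  have fl : h^-1 *: (flat k (h *: 1 + 0) - flat k 0) @[h --> 0^'] --> (0 : R).
    apply/cvgrPdist_le => eps eps0; near=> h.
    rewrite addr0 (flat_le0 k (lexx 0)) subr0 [_%:A]mulr1 sub0r normrN normrM.
    have [h0|h0] := leP h 0; first by rewrite flat_le0// normr0 mulr0 ltW.
    rewrite (ger0_norm (flat_ge0 _ _)) gtr0_norm ?invr_gt0//.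
    (* The difference quotient at 0 is the next member of the family, which [flat_le] bounds by a
       multiple of h. *)
    have -> : h^-1 * flat k h = flat k.+1 h.
      by rewrite /flat h0 mulrA exprS invfM.
    apply: le_trans (flat_le _ h0) _.
    rewrite -ler_pdivlMl ?ltr0n ?fact_gt0//.
    rewrite (le_trans (ler_norm h))//; near: h; apply: dnbhs0_le.
    by rewrite mulr_gt0// invr_gt0 ltr0n fact_gt0.
  split; first by apply/cvg_ex; exists 0.
  exact: cvg_lim fl.
Unshelve. all: by end_near. Qed.

Lemma differentiable_upto_flat (V : normedModType R) k j (U : set V) (f : V -> R) :
  open U -> differentiable_upto k U f ->
  differentiable_upto k U (flat j \o f).
Proof.
move=> oU; elim: k j f => // k IH j f kf; have [df ddf] := kf.
have dflat y : differentiable (flat j) y.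
  by apply/derivable1_diffP; case: (is_derive_flat j y).
split=> [x Ux|v]; first by apply: differentiable_comp; [exact: df|exact: dflat].
pose u x := 'D_v f x * ((flat j.+2 \o f) x + - j%:R * (flat j.+1 \o f) x).
apply: (@differentiable_upto_eq _ _ _ _ _ u) => //.
  move=> x Ux; rewrite deriveE; last by apply: differentiable_comp (df _ Ux) _.
  rewrite diff_comp//=; last exact: df.
  rewrite -(deriveE v (df _ Ux)) deriv1E; last by apply/derivable1_diffP.
  rewrite derive1E; have [_ ->] := is_derive_flat j (f x).
  by rewrite /u /= mulNr.
have fW := differentiable_uptoW kf.
apply: differentiable_uptoM => //; first exact: ddf.
apply: differentiable_uptoD => //; first exact: IH.
apply: differentiable_uptoM => //; last exact: IH.
exact: differentiable_upto_cst.
Qed.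

Lemma exists_bump m (O : set 'rV[R]_m) c : open O -> O c ->
  exists b : 'rV[R]_m -> R, [/\ smooth_on setT b, b c != 0 &
    exists2 K, compact K /\ K `<=` O & forall u, ~ K u -> b u = 0].
Proof.
move=> oO Oc; have /nbhs_ballP[eps /= eps0 epsO] := open_nbhs_nbhs (conj oO Oc).
(* With r half of [eps], the closed cube of half-side r around c lies in the open ball. In each
   coordinate the two flat factors are both positive exactly inside the cube. *)
have [r epsE] : exists r, eps = r + r by exists (eps / 2); lra.
have r0 : 0 < r by lra.
exists (fun u => \prod_i (flat 0 (r + c 0 i + -1 * u 0 i) *
                    flat 0 (r - c 0 i + u 0 i))).
split.
- move=> k; apply: differentiable_upto_prod => [|i]; first exact: openT.
  have uk : differentiable_upto k setT (fun u : 'rV[R]_m => u 0 i : R).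
    exact/(differentiable_upto_coord i openT)/differentiable_upto_id.
  apply: differentiable_uptoM => //; first exact: openT.
    apply: (differentiable_upto_flat 0 openT).
    apply: differentiable_uptoD => //; first exact: openT.
      exact: differentiable_upto_cst.
    apply: differentiable_uptoM => //; first exact: openT.
    exact: differentiable_upto_cst.
  apply: (differentiable_upto_flat 0 openT).
  apply: differentiable_uptoD => //; first exact: openT.
  exact: differentiable_upto_cst.
- rewrite prodf_seq_neq0; apply/allP => i _ /=.
  by rewrite mulf_neq0// gt_eqF// flat_gt0//; lra.
- exists [set v | forall i, `[c 0 i - r, c 0 i + r]%classic (v 0 i)]; first split.
  + apply: (@rV_compact R m (fun i => `[c 0 i - r, c 0 i + r]%classic)) => i.
     exact: segment_compact.
  + move=> v Kv; apply: epsO; split=> // i j; rewrite !ord1.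
    have := Kv j; rewrite /= in_itv/= => /andP[? ?].
    rewrite /ball/= ltr_norml; apply/andP; split; lra.
  + move=> u /existsNP[i]; rewrite /= in_itv/= => /negP.
    rewrite negb_and -!ltNge (bigD1 i)//= => /orP[] H.
      by rewrite (flat_le0 0 (x := r - c 0 i + u 0 i)) ?mulr0 ?mul0r//; lra.
    by rewrite flat_le0 ?mul0r//; lra.
Qed.

End Bump.

(** * Smooth functions on manifolds *)

Section Charts.
Context {R : realType} {n : nat} {M : manifoldType R n}.
Implicit Types (a b c : chart R n M) (f : M -> R).

Lemma parametrization_continuous_at a x : domain a x ->
  parametrization a u @[u --> coordinates a x] --> x.
Proof.
move=> ax; have := @parametrization_continuous _ _ _ a.
rewrite (continuous_open_subspace _ (@image_open _ _ _ a)) => ca.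
rewrite -{2}(chartK ax); apply: ca.
by rewrite inE; exists x.
Qed.

Lemma image_chart_open a (O : set M) :
  open O -> open (coordinates a @` (domain a `&` O)).
Proof.
move=> oO; rewrite openE => _ [x [ax Ox] <-]; rewrite /interior.
have aax : (coordinates a @` domain a) (coordinates a x) by exists x.
have : \forall u \near coordinates a x, O (parametrization a u).
  by apply: (parametrization_continuous_at ax); exact: open_nbhs_nbhs.
have := open_nbhs_nbhs (conj (@image_open _ _ _ a) aax).
apply: filterS2 => u [y ay <-]; rewrite chartK// => Oy.
by exists y.
Qed.

(** Smoothness may be checked near one point and for one order at a time; the neighbourhood [V] may
    depend on both. *)
Lemma smooth_functionsP f :
  (forall a k x, atlas a -> domain a x -> exists V,
     [/\ open V, V (coordinates a x) &
         differentiable_upto k V (f \o parametrization a)]) ->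
  smooth_functions M f.
Proof.
move=> sf a aa k; apply: differentiable_upto_local => _ [x ax <-].
have [V [oV Vx]] := sf a k x aa ax; apply: differentiable_upto_sub.
by move=> _ ->.
Qed.

Lemma smooth_functions_cst (c : R) : smooth_functions M (fun=> c).
Proof. by move=> a aa k; exact: differentiable_upto_cst. Qed.

Lemma smooth_functionsD f g : smooth_functions M f -> smooth_functions M g ->
  smooth_functions M (fun x => f x + g x).
Proof.
move=> sf sg a aa k.
exact: (differentiable_uptoD (@image_open _ _ _ a) (sf a aa k) (sg a aa k)).
Qed.

Lemma smooth_functionsM f g : smooth_functions M f -> smooth_functions M g ->
  smooth_functions M (fun x => f x * g x).
Proof.
move=> sf sg a aa k.
exact: (differentiable_uptoM (@image_open _ _ _ a) (sf a aa k) (sg a aa k)).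
Qed.

Lemma smooth_functionsZ (c : R) f : smooth_functions M f ->
  smooth_functions M (fun x => c * f x).
Proof. exact/smooth_functionsM/smooth_functions_cst. Qed.

(** Extension by zero of a function compactly supported in a chart. Inside the domain it is b after
    a change of charts; elsewhere it vanishes nearby, because the support is closed in M. *)
Lemma smooth_functions_extend a (b : 'rV[R]_n -> R) K : atlas a ->
  smooth_on setT b -> compact K -> K `<=` coordinates a @` domain a ->
  (forall u, ~ K u -> b u = 0) ->
  smooth_functions M (fun x => if `[<domain a x>] then b (coordinates a x) else 0).
Proof.
move=> aa sb cK Ka bK; apply: smooth_functionsP => c k x ac cx.
have [ax|nax] := pselect (domain a x).
  exists (coordinates c @` (domain c `&` domain a)); split.
  - by apply: image_chart_open; exact: domain_open.
  - by exists x.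
  have oV := @image_chart_open c _ (@domain_open _ _ _ a).
  have := differentiable_upto_comp oV openT (fun _ _ => I)
    (@atlas_compatible _ _ _ c a ac aa k) (sb k).
  apply: differentiable_upto_eq => // _ [y [cy ay] <-] /=.
  by rewrite chartK// ifT//; exact/asboolP.
pose K' := parametrization a @` K.
have K'a y : K' y -> domain a y.
  by move=> [u /Ka[z az <-] <-]; rewrite chartK.
(* The Hausdorff property enters here: a compact subset of M is closed. *)
have cK' : closed K'.
  apply: compact_closed; first exact: manifold_hausdorff.
  apply: continuous_compact cK.
  exact: continuous_subspaceW Ka (@parametrization_continuous _ _ _ a).
exists (coordinates c @` (domain c `&` ~` K')); split.
- by apply: image_chart_open; exact: closed_openC.
- by exists x => //; split=> // /K'a.
have oV : open (coordinates c @` (domain c `&` ~` K')).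
  by apply: image_chart_open; exact: closed_openC.
apply: (differentiable_upto_eq oV _ (differentiable_upto_cst _ _ 0)).
move=> _ [y [cy K'y] <-] /=; rewrite chartK//; case: asboolP => // ay.
by rewrite bK// => Ky; apply: K'y; exists (coordinates a y) => //; rewrite chartK.
Qed.

End Charts.

Lemma smooth_functions_comp (R : realType) (m n : nat) (M : manifoldType R m)
    (N : manifoldType R n) (F : M -> N) (f : N -> R) :
  smooth_map F -> smooth_functions N f -> smooth_functions M (f \o F).
Proof.
move=> [cF sF] sf; apply: smooth_functionsP => a k x aa ax.
have [b ab bFx] := atlas_cover (F x).
have oF : open (F @^-1` domain b).
  by apply: open_comp (@domain_open _ _ _ b) => y _; exact: cF.
exists (coordinates a @` (domain a `&` F @^-1` domain b)).
have oV := @image_chart_open _ _ _ a _ oF.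
split=> //; first by exists x.
have := differentiable_upto_comp oV (@image_open _ _ _ b) _
  (sF a b aa ab k) (sf b ab k).
have H : forall u, (coordinates a @` (domain a `&` F @^-1` domain b)) u ->
    (coordinates b @` domain b) ((coordinates b \o F \o parametrization a) u).
  move=> _ [y [ay bFy] <-]; exists (F y) => //=.
  by rewrite chartK.
move=> /(_ H); apply: differentiable_upto_eq => // _ [y [ay bFy] <-] /=.
by rewrite !chartK.
Qed.

Lemma smooth_map2_left (R : realType) (m n p : nat) (M : manifoldType R m)
    (N : manifoldType R n) (Q : manifoldType R p) (F : M * N -> Q) (y : N) :
  smooth_map2 F -> smooth_map (fun x => F (x, y)).
Proof.
move=> [cF sF]; split.
  move=> x; apply: (@continuous_comp _ _ _ (fun x => (x, y)) F); last exact: cF.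
  by apply: cvg_pair => //; exact: cvg_cst.
move=> a c aa ac k; have [b ab by_] := atlas_cover y.
have := differentiable_upto_slice (coordinates b y) (sF a b c aa ab ac k).
rewrite [X in _ -> differentiable_upto _ _ X](_ : _ = fun u =>
  coordinates c (F (parametrization a u, parametrization b (coordinates b y)))).
  apply: differentiable_upto_sub => _ [x [ax cFx] <-] /=.
  by exists (x, y).
by apply/funext => u /=; rewrite chartK.
Qed.

(** * Differentiating curves known only through smooth functions *)

Section Curves.
Context {R : realType}.

(* The exponential map is only known through global smooth functions
   ([expo_flow]); not even its continuity is part of the structure. *)
Definition tested_derivable {n} {M : manifoldType R n} (p : R -> M) (t : R) :=
  forall f, smooth_functions M f -> derivable (f \o p) t 1.

(** A bump function [H] supported in the chart is nonzero at p t. As [H \o p] is continuous at t, it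
    stays nonzero nearby, which keeps p in the domain of the chart. *)
Lemma tested_derivable_chart {n} {M : manifoldType R n} (p : R -> M) (t : R)
    (a : chart R n M) : tested_derivable p t -> atlas a -> domain a (p t) ->
  (\forall s \near t, domain a (p s)) /\ differentiable (coordinates a \o p) t.
Proof.
move=> dp aa apt.
have [b [sb b0 [K [cK Ka] bK]]] := exists_bump (@image_open _ _ _ a)
  (ex_intro2 _ _ (p t) apt erefl :
    (coordinates a @` domain a) (coordinates a (p t))).
pose H x := if `[<domain a x>] then b (coordinates a x) else 0.
have sH : smooth_functions M H := smooth_functions_extend aa sb cK Ka bK.
have Hpt : (H \o p) t != 0 by rewrite /H /= ifT//; exact/asboolP.
have ap : \forall s \near t, H (p s) != 0.
  have := dp _ sH => /derivable1_diffP/differentiable_continuous.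
  by move=> cH; exact: cvgr_neq0 cH Hpt.
have aps : \forall s \near t, domain a (p s).
  near=> s; have : H (p s) != 0 by near: s.
  by rewrite /H; case: asboolP => //; rewrite eqxx.
split=> //; apply/derivable1_diffP/derivable_mxP => i j; rewrite ord1.
(* A coordinate function does not extend to M, but its product with the bump function does; near t
   the coordinate of p is the quotient of [Hj \o p] by [H \o p]. *)
pose bj (u : 'rV[R]_n) := b u * u 0 j.
have sbj : smooth_on setT bj.
  move=> k; apply: (differentiable_uptoM openT) => //.
  exact/(differentiable_upto_coord j openT)/differentiable_upto_id.
pose Hj x := if `[<domain a x>] then bj (coordinates a x) else 0.
have sHj : smooth_functions M Hj.
  apply: smooth_functions_extend aa sbj cK Ka _ => u /bK.
  by rewrite /bj => ->; rewrite mul0r.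
apply: (@near_eq_derivable _ _ _ (fun s => (Hj \o p) s * ((H \o p) s)^-1)).
- near=> s; have : H (p s) != 0 by near: s.
  have : domain a (p s) by near: s.
  move=> aps'; rewrite /H /Hj /= ifT ?ifT; try exact/asboolP.
  by move=> bn0; rewrite /bj mulrAC mulfV// mul1r.
- apply: derivableM; first exact: dp.
  by apply: derivableV => //; exact: dp.
Unshelve. all: by end_near. Qed.

(** In charts this is additivity of the differential on (u', v') = (u', 0) + (0, v'). *)
Lemma derive_smooth_map2 {m n q} {M : manifoldType R m} {N : manifoldType R n}
    {Q : manifoldType R q} (F : M * N -> Q) (g : Q -> R) (c : R -> M)
    (d : R -> N) (t : R) :
  smooth_map2 F -> smooth_functions Q g ->
  tested_derivable c t -> tested_derivable d t ->
  'D_1 (fun s => g (F (c s, d s))) t =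
  'D_1 (fun s => g (F (c s, d t))) t + 'D_1 (fun s => g (F (c t, d s))) t.
Proof.
move=> sF sg dc dd.
have [a aa ac] := atlas_cover (c t).
have [b ab bd] := atlas_cover (d t).
have [e ae eF] := atlas_cover (F (c t, d t)).
have [near_c diff_c] := tested_derivable_chart dc aa ac.
have [near_d diff_d] := tested_derivable_chart dd ab bd.
have [cF /(_ a b e aa ab ae 1%N)[dF _]] := sF.
pose Phi (uv : 'rV[R]_m * 'rV[R]_n) :=
  g (F (parametrization a uv.1, parametrization b uv.2)).
pose u0 := coordinates a (c t); pose v0 := coordinates b (d t).
have dPhi : differentiable Phi (u0, v0).
  (* The chart [e] can be inserted between F and g only where F stays in its domain. *)
  have near_F : \forall uv \near (u0, v0),
      domain e (F (parametrization a uv.1, parametrization b uv.2)).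
    have : F (parametrization a uv.1, parametrization b uv.2)
        @[uv --> (u0, v0)] --> F (c t, d t).
      apply: (@cvg_comp _ _ _
        (fun uv => (parametrization a uv.1, parametrization b uv.2)) F);
        last exact: cF.
      apply: cvg_pair.
        apply: (@cvg_comp _ _ _ fst (parametrization a)); first exact: cvg_fst.
        exact: parametrization_continuous_at.
      apply: (@cvg_comp _ _ _ snd (parametrization b)); first exact: cvg_snd.
      exact: parametrization_continuous_at.
    by apply; exact: (open_nbhs_nbhs (conj (@domain_open _ _ _ e) eF)).
  pose Psi := (g \o parametrization e) \o (fun uv : 'rV[R]_m * 'rV[R]_n =>
    coordinates e (F (parametrization a uv.1, parametrization b uv.2))).
  apply: (@near_eq_differentiable _ _ _ Psi).
    by near=> uv; rewrite /Psi /= chartK//; near: uv.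
  apply: differentiable_comp; first by apply: dF; exists (c t, d t).
  have [dg _] := sg e ae 1%N; apply: dg.
  by exists (F (c t, d t)) => //=; rewrite !chartK.
have E x y : domain a x -> domain b y ->
  g (F (x, y)) = Phi (coordinates a x, coordinates b y).
  by move=> ax bd'; rewrite /Phi /= !chartK.
(* Stated for all pairs of curves through the same points, so that it also covers the two pairs with
   one constant member. *)
have D (c' : R -> M) (d' : R -> N) : c' t = c t -> d' t = d t ->
    (\forall s \near t, domain a (c' s)) -> (\forall s \near t, domain b (d' s)) ->
    differentiable (coordinates a \o c') t ->
    differentiable (coordinates b \o d') t ->
    'D_1 (fun s => g (F (c' s, d' s))) t =
    'd Phi (u0, v0) ('D_1 (coordinates a \o c') t, 'D_1 (coordinates b \o d') t).
  move=> c't d't nc' nd' dc' dd'.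
  have -> : 'D_1 (fun s => g (F (c' s, d' s))) t =
      'D_1 (Phi \o (fun s => ((coordinates a \o c') s, (coordinates b \o d') s))) t.
    by apply: near_eq_derive; near=> s; apply: E; near: s.
  have dpair := differentiable_pair dc' dd'.
  have dPhi' : differentiable Phi ((coordinates a \o c') t, (coordinates b \o d') t).
    by rewrite /= c't d't.
  rewrite deriveE; last exact: differentiable_comp.
  rewrite diff_comp//= diff_pair//= c't d't.
  by rewrite deriveE// deriveE.
rewrite (D c d)//.
rewrite (D c (fun=> d t))//; last 2 first.
- by near=> s.
- exact: differentiable_cst.
rewrite (D (fun=> c t) d)//; last 2 first.
- by near=> s.
- exact: differentiable_cst.
rewrite -linearD; congr ('d _ _ _); congr pair => /=.
  by rewrite (_ : _ \o (fun=> c t) = cst u0)// derive_cst addr0.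
by rewrite (_ : _ \o (fun=> d t) = cst v0)// derive_cst add0r.
Unshelve. all: by end_near. Qed.

End Curves.

(** * Invariant vector fields *)

Section VectorFields.
Context {R : realType} {M : Type} {C : set (M -> R)}.
Variable X : (M -> R) -> M -> R.
Hypothesis vX : is_vector_field C X.
Hypothesis C0 : C (fun=> 0).

Lemma vector_field0 : X (fun=> 0) = fun=> 0.
Proof.
have := vf_linear vX 1 C0 C0.
rewrite (_ : (fun x : M => 1 * 0 + 0) = fun=> 0); last first.
  by apply/funext => x; rewrite mulr0 addr0.
move=> E; apply/funext => x; have := congr1 (fun u => u x) E.
by rewrite /= mul1r => /eqP; rewrite -subr_eq0 opprD addNKr oppr_eq0 => /eqP.
Qed.

Lemma vector_fieldZ (a : R) f : C f ->
  X (fun x => a * f x) = fun x => a * X f x.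
Proof.
move=> Cf; have := vf_linear vX a Cf C0; rewrite vector_field0.
rewrite (_ : (fun x => a * f x + 0) = fun x => a * f x); last first.
  by apply/funext => x; rewrite addr0.
by move=> ->; apply/funext => x; rewrite addr0.
Qed.

Lemma vector_fieldN f : C f -> X (fun x => - f x) = fun x => - X f x.
Proof.
move=> Cf; rewrite (_ : (fun x => - f x) = fun x => -1 * f x); last first.
  by apply/funext => x; rewrite mulN1r.
by rewrite vector_fieldZ//; apply/funext => x; rewrite mulN1r.
Qed.

Lemma vector_fieldD f g : C f -> C g ->
  X (fun x => f x + g x) = fun x => X f x + X g x.
Proof.
move=> Cf Cg; have := vf_linear vX 1 Cf Cg.
rewrite (_ : (fun x => 1 * f x + g x) = fun x => f x + g x); last first.
  by apply/funext => x; rewrite mul1r.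
by move=> ->; apply/funext => x; rewrite mul1r.
Qed.

Lemma vector_field_sum (I : Type) (s : seq I) (f : I -> M -> R) :
  (forall g1 g2, C g1 -> C g2 -> C (fun x => g1 x + g2 x)) ->
  (forall i, C (f i)) ->
  X (fun x => \sum_(i <- s) f i x) = fun x => \sum_(i <- s) X (f i) x.
Proof.
move=> CD Cf; pose F (s : seq I) x := \sum_(i <- s) f i x.
have Fnil : F [::] = fun=> 0 by apply/funext => x; rewrite /F big_nil.
have Fcons i r : F (i :: r) = fun x => f i x + F r x.
  by apply/funext => x; rewrite /F big_cons.
(* Membership of the partial sums in C is carried along, since X is additive on C only. *)
suff [_ ->//] : C (F s) /\ X (F s) = fun x => \sum_(i <- s) X (f i) x.
elim: s => [|i s [CF IH]].
  by rewrite Fnil vector_field0; split=> //; apply/funext => x; rewrite big_nil.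
rewrite Fcons vector_fieldD// IH; split; first exact: CD.
by apply/funext => x; rewrite big_cons.
Qed.

End VectorFields.

Section LieGroups.
Context {R : realType} {n : nat} {D : lieGroupType R n}.
Local Notation Coo := (smooth_functions D).
Implicit Types (f : D -> R) (d : D).

Lemma smooth_functions_inv f : Coo f -> Coo (fun y => f (y^-1)%g).
Proof. exact: smooth_functions_comp inv_smooth. Qed.

Lemma smooth_functions_mulr d f : Coo f -> Coo (fun y => f (y * d)%g).
Proof. exact: smooth_functions_comp (smooth_map2_left d mul_smooth). Qed.

(** Left translation is right translation conjugated by inversion: d y = (y^-1 d^-1)^-1. *)
Lemma smooth_functions_mull d f : Coo f -> Coo (fun y => f (d * y)%g).
Proof.
move=> /smooth_functions_inv/(smooth_functions_mulr (d^-1)%g)/smooth_functions_inv.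
congr Coo; apply/funext => y.
by rewrite invgM !invgK.
Qed.

Variable L : lieAlgebra D.
Implicit Types X Y : L.

Lemma lambda_vector_field X : is_vector_field Coo (lambda X).
Proof. by case: (lambda_left_invariant X). Qed.

Lemma lambdaE X f d : Coo f -> lambda X f d = lambda X (fun y => f (d * y)%g) 1%g.
Proof.
move=> sf; have [_ /(_ f sf d 1%g)] := lambda_left_invariant X.
by rewrite mulg1.
Qed.

Lemma expo_tested_derivable X t : tested_derivable (fun s => expo (s *: X)) t.
Proof. by move=> f sf; case: (expo_flow X t sf). Qed.

Lemma derive_expo X f : Coo f ->
  'D_1 (fun t : R => f (expo (t *: X))) 0 = lambda X f 1%g.
Proof.
by move=> sf; have [_ ->] := expo_flow X 0 sf; rewrite scale0r expo0.
Qed.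

(** Inversion has differential -1 at the identity: the two partial derivatives of f (exp(tX)
    exp(tX)^-1), a constant function of t, add up to zero. *)
Lemma lambda1_inv X f : Coo f ->
  lambda X (fun y => f (y^-1)%g) 1%g = - lambda X f 1%g.
Proof.
move=> sf; have sfi := smooth_functions_inv sf.
have dp := @expo_tested_derivable X 0.
have dq : tested_derivable (fun t : R => (expo (t *: X))^-1)%g 0.
  by move=> u /smooth_functions_inv/dp.
have := derive_smooth_map2 mul_smooth sf dp dq.
rewrite /= scale0r expo0 invg1.
under [fun s : R => f (_ * _^-1)%g]eq_fun do rewrite mulgV.
under [fun s : R => f (_ * 1)%g]eq_fun do rewrite mulg1.
under [fun s : R => f (1 * _)%g]eq_fun do rewrite mul1g.
rewrite derive_cst derive_expo// (derive_expo X sfi) => /esym/eqP.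
by rewrite addrC addr_eq0 => /eqP.
Qed.

(** Inversion exchanges right and left translations. The formula transfers smoothness and brackets
    from left-invariant to right-invariant fields. *)
Lemma rho_lambda_inv X f d : Coo f ->
  rho X f d = - lambda X (fun y => f (y^-1)%g) (d^-1)%g.
Proof.
move=> sf; rewrite lambdaE; last exact: smooth_functions_inv.
have sfid := smooth_functions_mull (d^-1)%g (smooth_functions_inv sf).
rewrite -(lambda1_inv X sfid).
rewrite /rho; congr (lambda X _ _); apply/funext => y.
by rewrite invgM !invgK.
Qed.

Lemma rho_vector_field X : is_vector_field Coo (rho X).
Proof.
have vX := lambda_vector_field X; split.
- move=> f sf; have /smooth_functions_inv := vf_smooth vX (smooth_functions_inv sf).
  move=> /(smooth_functionsZ (-1)); congr Coo.
  by apply/funext => d; rewrite rho_lambda_inv// mulN1r.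
- move=> a f g sf sg; apply/funext => d; rewrite /rho.
  by rewrite (vf_linear vX a (smooth_functions_mulr d sf) (smooth_functions_mulr d sg)).
- move=> f g sf sg; apply/funext => d; rewrite /rho.
  rewrite (vf_leibniz vX (smooth_functions_mulr d sf) (smooth_functions_mulr d sg)).
  by rewrite mul1g.
Qed.

Lemma rho_linear (a : R) X Y f d : Coo f ->
  rho (a *: X + Y) f d = a * rho X f d + rho Y f d.
Proof.
by move=> /(smooth_functions_mulr d) sf; rewrite /rho lambda_linear.
Qed.

(** In a composite of two right-invariant fields the signs of [rho_lambda_inv] cancel, while the
    field of the bracket keeps its single sign; hence the reversed order. *)
Lemma rho_bracket X Y f d : Coo f ->
  rho (bracket X Y) f d = rho Y (rho X f) d - rho X (rho Y f) d.
Proof.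
move=> sf; have sfi := smooth_functions_inv sf.
have rr (U V : L) : rho U (rho V f) d =
    lambda U (lambda V (fun y => f (y^-1)%g)) (d^-1)%g.
  have sV := vf_smooth (lambda_vector_field V) sfi.
  rewrite rho_lambda_inv; last first.
    exact: (vf_smooth (rho_vector_field V) sf).
  under [fun y => rho V f _]eq_fun do rewrite rho_lambda_inv// invgK.
  rewrite (vector_fieldN (lambda_vector_field U) (smooth_functions_cst 0) sV).
  by rewrite opprK.
by rewrite !rr rho_lambda_inv// lambda_bracket// opprB.
Qed.

Lemma lambda_inj X Y : (forall f, Coo f -> lambda X f = lambda Y f) -> X = Y.
Proof.
move=> XY; have [Z [_ Zu]] := @lambda_bijective _ _ _ L _ (lambda_left_invariant X).
by rewrite -(Zu X)// -(Zu Y)// => f /XY.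
Qed.

Lemma bracketC X Y : bracket X Y = - bracket Y X.
Proof.
apply: lambda_inj => f sf.
rewrite -[- _]addr0 -scaleN1r lambda_linear// !lambda_bracket//.
have -> : lambda (0 : L) f = fun=> 0.
  transitivity (lambda (-1 *: (0 : L) + 0) f); first by rewrite scaler0 addr0.
  rewrite lambda_linear//; apply/funext => d.
  by rewrite mulN1r addNr.
by apply/funext => d; rewrite mulN1r addr0 opprB.
Qed.

(** [Z] is the push-forward of X^lambda by y |-> y d^-1. It is again left-invariant because left and
    right translations commute, so [lambda_bijective] provides Y. *)
Lemma exists_Ad d X : exists Y, is_Ad d X Y.
Proof.
pose Z f x := lambda X (fun y => f (y * d^-1)%g) (x * d)%g.
have vX := lambda_vector_field X.
have vZ : left_invariant_field Z.
  split; first split.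
  - move=> f sf; apply: smooth_functions_mulr; apply: (vf_smooth vX).
    exact: smooth_functions_mulr.
  - move=> a f g sf sg; rewrite /Z (vf_linear vX)//; exact: smooth_functions_mulr.
  - move=> f g sf sg; rewrite /Z (vf_leibniz vX); try exact: smooth_functions_mulr.
    by apply/funext => x; rewrite mulgK.
  - move=> f sf a x; have [_ lX] := lambda_left_invariant X.
    have := lX _ (smooth_functions_mulr (d^-1)%g sf) a (x * d)%g.
    rewrite mulgA /Z => ->; congr (lambda X _ _).
    by apply/funext => y; rewrite mulgA.
have [Y [YZ _]] := @lambda_bijective _ _ _ L _ vZ; exists Y => f sf.
rewrite YZ// /Z mul1g lambdaE; last exact: smooth_functions_mulr.
by [].
Qed.

Lemma rho_Ad d X Y f : is_Ad (d^-1)%g X Y -> Coo f -> rho X f d = lambda Y f d.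
Proof.
move=> XY sf; rewrite lambdaE// XY; last exact: smooth_functions_mull.
congr (lambda X _ _); apply/funext => y.
by rewrite invgK -!mulgA mulVKg.
Qed.

(** The derivative is taken along d exp(tX), on which f is constant. *)
Lemma lambda_right_invariant (G : set D) X f d : Coo f ->
  (forall t, G (expo (t *: X))) -> (forall y x, G x -> f (y * x)%g = f y) ->
  lambda X f d = 0.
Proof.
move=> sf GX fG; have sfd := smooth_functions_mull d sf.
rewrite lambdaE// -(derive_expo X sfd).
by under eq_fun do rewrite fG//; exact: derive_cst.
Qed.

End LieGroups.

(** * Hyperbolic bases *)

Section DualBases.
Context {R : realType} {L : vectType R} (B : {symmetric L}).
Implicit Types (U V : {vspace L}) (X Y : L).

Lemma symmetricC X Y : B X Y = B Y X.
Proof. by rewrite hermC expr0 mul1r. Qed.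

Lemma linfunE (aT rT : vectType R) (f : aT -> rT) : linear f -> linfun f =1 f.
Proof.
move=> lf; pose fM := GRing.isLinear.Build _ _ _ _ f lf.
pose fL : {linear _ -> _} := HB.pack f fM.
exact: (lfunE fL).
Qed.

(** For U = h and V = g this is [j_inv]. Both orders of g and h are needed to compare their
    dimensions. *)
Definition pairing_map U V : 'Hom(subvs_of U, 'Hom(subvs_of V, R^o)) :=
  linfun (fun y : subvs_of U =>
    linfun (fun x : subvs_of V => B (vsval y) (vsval x) : R^o)).

Lemma pairing_mapE U V (y : subvs_of U) (x : subvs_of V) :
  pairing_map U V y x = B (vsval y) (vsval x).
Proof.
have inner (z : subvs_of U) :
    linear (fun x : subvs_of V => B (vsval z) (vsval x) : R^o).
  by move=> a u v; rewrite !linearP.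
rewrite /pairing_map linfunE ?linfunE//.
move=> a u v; apply/lfunP => w; rewrite add_lfunE scale_lfunE !linfunE//.
by rewrite linearP linearPl.
Qed.

Lemma pairing_map_lker0 U V :
  (forall y, y \in U -> (forall x, x \in V -> B y x = 0) -> y = 0) ->
  lker (pairing_map U V) == 0%VS.
Proof.
move=> ndg; apply/lker0P => y1 y2 E; apply/val_inj/eqP.
rewrite -subr_eq0; apply/eqP/ndg; first by rewrite rpredB// subvsP.
move=> x xV; have := congr1 (fun u : 'Hom(_, _) => u (vsproj V x)) E.
rewrite !pairing_mapE vsprojK// => E'.
by rewrite linearBl/= E' subrr.
Qed.

Lemma pairing_map_dim U V : lker (pairing_map U V) == 0%VS ->
  (\dim U <= \dim V)%N.
Proof.
move=> k0; have := @limg_dim_eq _ _ _ (pairing_map U V) fullv.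
rewrite (eqP k0) capv0 => /(_ erefl).
have := dimvS (subvf (limg (pairing_map U V))).
rewrite !dimvf => le E; rewrite E in le.
rewrite -[\dim V]muln1; exact: le.
Qed.

End DualBases.

Section HyperbolicBasis.
Context {R : realType} {n : nat} {D : lieGroupType R n.*2} {L : lieAlgebra D}.
Context {B : {symmetric L}} {g h : {vspace L}} {e : (\dim g).-tuple L}.
Hypothesis ndgB : nondegenerate B.
Hypothesis isog : isotropic B g.
Hypothesis isoh : isotropic B h.
Hypothesis direct : (g :&: h)%VS = 0%VS.
Hypothesis sum : (g + h)%VS = fullv.
Hypothesis e_basis : basis_of g e.

Local Notation jdual := (fun i => j B h (dual_basis e i)).

Lemma nondegenerate_eq0 X : (forall Y, B X Y = 0) -> X = 0.
Proof.
move=> X0; apply/eqP; rewrite -memv0 -(eqP ndgB).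
by apply/mem_orthovP => Y _; exact: X0.
Qed.

Lemma direct_sumP (Y : L) : exists a b, [/\ a \in g, b \in h & Y = a + b].
Proof.
have : Y \in (g + h)%VS by rewrite sum memvf.
by move=> /memv_addP[a ag [b bh ->]]; exists a, b.
Qed.

Lemma pairing_inj_h y : y \in h -> (forall x, x \in g -> B y x = 0) -> y = 0.
Proof.
move=> yh y0; apply: nondegenerate_eq0 => Y.
have [a [b [ag bh ->]]] := direct_sumP Y.
by rewrite linearDr/= (y0 a ag) (isoh yh bh) addr0.
Qed.

Lemma pairing_inj_g x : x \in g -> (forall y, y \in h -> B x y = 0) -> x = 0.
Proof.
move=> xg x0; apply: nondegenerate_eq0 => Y.
have [a [b [ag bh ->]]] := direct_sumP Y.
by rewrite linearDr/= (x0 b bh) (isog xg ag) addr0.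
Qed.

(** The formal inverse is a right inverse on the image only, so surjectivity is required. The
    pairings of h with g and of g with h are both injective, hence the dimensions agree. *)
Lemma j_invK (xi : dual g) : j_inv B g h ((j_inv B g h)^-1%VF xi) = xi.
Proof.
have k_h := pairing_map_lker0 pairing_inj_h.
have k_g := pairing_map_lker0 pairing_inj_g.
apply: limg_lfunVK; have := subvf (limg (pairing_map B h g)).
have E := @limg_dim_eq _ _ _ (pairing_map B h g) fullv.
rewrite (eqP k_h) capv0 in E.
have dim_hg : \dim h = \dim g.
  by apply/eqP; rewrite eqn_leq (pairing_map_dim k_h) (pairing_map_dim k_g).
suff /eqP -> : limg (pairing_map B h g) == fullv by rewrite memvf.
rewrite eqEdim subvf (E erefl) !dimvf.
rewrite (_ : dim _ = (\dim g * 1)%N)// muln1 -dim_hg.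
exact: leqnn.
Qed.

Lemma j_mem (xi : dual g) : j B h xi \in h.
Proof. exact: subvsP. Qed.

Lemma jE (xi : dual g) x : x \in g -> B (j B h xi) x = xi (vsproj g x).
Proof.
move=> xg; rewrite -{2}(j_invK xi) [RHS]pairing_mapE vsprojK//.
Qed.

Lemma dual_basisE i (x : subvs_of g) : dual_basis e i x = coord e i (vsval x).
Proof. by rewrite linfunE// => a u v; rewrite !linearP. Qed.

Lemma tnth_basis_mem i : tnth e i \in g.
Proof. by apply: basis_mem e_basis _; exact: mem_tnth. Qed.

Lemma coord_jdual x i : x \in g -> coord e i x = B x (jdual i).
Proof.
by move=> xg; rewrite symmetricC jE// dual_basisE vsprojK.
Qed.

(** The part of Y in g is expanded in the basis e, whose coordinates are pairings with the j
    eps^i. *)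
Lemma hyperbolic_expansion (Y : L) :
  Y = \sum_i B Y (jdual i) *: tnth e i + \sum_i B Y (tnth e i) *: jdual i.
Proof.
have [a [b [ag bh ->]]] := direct_sumP Y.
congr (_ + _).
  rewrite {1}(coord_basis e_basis ag); apply: eq_bigr => i _.
  rewrite -tnth_nth coord_jdual//; congr (_ *: _).
  by rewrite linearDl/= (isoh bh (j_mem _)) addr0.
(* For the part in h, the difference of the two sides lies in h and is orthogonal to g, hence is
   zero. *)
apply/eqP; rewrite -subr_eq0; apply/eqP; apply: pairing_inj_h.
  rewrite rpredB// rpred_sum// => i _; rewrite rpredZ// j_mem//.
move=> x xg; rewrite linearBl/= linear_sumlz/=.
rewrite {1}(coord_basis e_basis xg) linear_sumr/= -sumrB big1// => i _.
rewrite -tnth_nth linearZr/= linearZl_LR/= linearDl/=.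
rewrite (isog ag (tnth_basis_mem i)) add0r coord_jdual// (symmetricC B x).
by rewrite mulrC subrr.
Qed.

(** The projection to h may be dropped: the component in g is orthogonal to x since g is
    isotropic. *)
Lemma F_tensorE (x : subvs_of g) i k :
  F_tensor B h x (dual_basis e i) (dual_basis e k) =
  B (bracket (jdual i) (jdual k)) (vsval x).
Proof.
rewrite /F_tensor [LHS]pairing_mapE; set Y := bracket _ _.
rewrite vsprojK; last exact: memv_pi.
have YE : Y = p_g g h Y + p_h g h Y.
  by rewrite /p_g /p_h daddv_pi_add// sum memvf.
by rewrite [in RHS]YE linearDl/= (isog (memv_pi g h Y) (subvsP x)) add0r.
Qed.

(** Here the component in h is orthogonal to j eps^m since h is isotropic. *)
Lemma phi_tensorE i k m :
  phi_tensor B h (dual_basis e i) (dual_basis e k) (dual_basis e m) =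
  B (bracket (jdual i) (jdual k)) (jdual m).
Proof.
rewrite /phi_tensor dual_basisE; set Y := bracket _ _.
rewrite vsprojK; last exact: memv_pi.
rewrite coord_jdual; last exact: memv_pi.
have YE : Y = p_g g h Y + p_h g h Y.
  by rewrite /p_g /p_h daddv_pi_add// sum memvf.
by rewrite [in RHS]YE linearDl/= (isoh (memv_pi h g Y) (j_mem _)) addr0.
Qed.

(** g contains its orthogonal: the coefficients of Y on the j eps^i are its pairings with the
    e_i. *)
Lemma isotropic_orthogonal (Y : L) : (forall x, x \in g -> B Y x = 0) -> Y \in g.
Proof.
move=> Y0; rewrite (hyperbolic_expansion Y) [X in _ + X]big1 ?addr0.
  by apply: rpred_sum => i _; rewrite rpredZ// tnth_basis_mem.
by move=> i _; rewrite Y0 ?scale0r// tnth_basis_mem.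
Qed.

End HyperbolicBasis.

(** * Quasi-Poisson identities *)

Section QuasiPoissonAlgebra.
Context {R : realType} {M : Type} {C : set (M -> R)}.
Context {L : vectType R} {B : {symmetric L}} {brk : L -> L -> L}.
Context {I : finType} {e t : I -> L} {V : L -> (M -> R) -> M -> R}.
Implicit Types (f k l : M -> R) (m : M) (X Y Z : L).

Hypothesis C_cst : forall c : R, C (fun=> c).
Hypothesis C_add : forall f k, C f -> C k -> C (fun m => f m + k m).
Hypothesis C_mul : forall f k, C f -> C k -> C (fun m => f m * k m).
Hypothesis V_field : forall X, is_vector_field C (V X).
Hypothesis V_bracket : forall X Y f m, C f ->
  V (brk X Y) f m = V X (V Y f) m - V Y (V X f) m.
Hypothesis V_expansion : forall Z f m, C f ->
  V Z f m = \sum_i B Z (t i) * V (e i) f m + \sum_i B Z (e i) * V (t i) f m.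
Hypothesis V_coisotropic : forall f k m, C f -> C k ->
  \sum_i (V (e i) f m * V (t i) k m + V (t i) f m * V (e i) k m) = 0.
Hypothesis brkC : forall X Y, brk X Y = - brk Y X.
Hypothesis B_invariant : forall X Y Z, B (brk X Y) Z = B X (brk Y Z).
Hypothesis e_closed : forall i j p, B (brk (e i) (e j)) (e p) = 0.

(** P_S in abstract form, with [t i] in the role of j eps^i; the duality of the two families enters
    through [V_expansion]. *)
Definition r_bivector f k m : R := - \sum_i V (e i) f m * V (t i) k m.
Local Notation P := r_bivector.

Lemma V_mem X f : C f -> C (V X f). Proof. exact: (vf_smooth (V_field X)). Qed.

Lemma r_bivector_term_mem f k i : C f -> C k ->
  C (fun m => V (e i) f m * V (t i) k m).
Proof. by move=> Cf Ck; apply: C_mul; exact: V_mem. Qed.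

Lemma r_bivector_mem f k : C f -> C k -> C (P f k).
Proof.
move=> Cf Ck; rewrite (_ : P f k = fun m =>
    \sum_i (-1 * V (e i) f m) * V (t i) k m); last first.
  apply/funext => m; rewrite /P -sumrN; apply: eq_bigr => i _.
  by rewrite mulN1r mulNr.
elim: (index_enum I) => [|i s IH].
  under [fun m => _]eq_fun do rewrite big_nil.
  exact: C_cst.
under [fun m => _]eq_fun do rewrite big_cons.
apply: C_add => //; apply: C_mul; last exact: V_mem.
by apply: C_mul; [exact: C_cst|exact: V_mem].
Qed.

Lemma r_bivector_skew f k m : C f -> C k -> P f k m = - P k f m.
Proof.
move=> Cf Ck; rewrite /P opprK; apply/eqP; rewrite -subr_eq0 -opprD oppr_eq0.
rewrite -big_split/= -[X in _ == X](V_coisotropic m Cf Ck); apply/eqP.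
by apply: eq_bigr => i _; congr (_ + _); exact: mulrC.
Qed.

Lemma V_r_bivector X f k m : C f -> C k -> V X (P f k) m =
  - \sum_i (V X (V (e i) f) m * V (t i) k m + V (e i) f m * V X (V (t i) k) m).
Proof.
move=> Cf Ck; have Cfk i := r_bivector_term_mem i Cf Ck.
pose S m := \sum_i V (e i) f m * V (t i) k m.
have CS : C S.
  rewrite (_ : S = fun m => -1 * P f k m).
    by apply: C_mul; [exact: C_cst|exact: r_bivector_mem].
  by apply/funext => m'; rewrite mulN1r opprK.
rewrite (vector_fieldN (V_field X) (C_cst 0) CS); congr (- _).
rewrite (vector_field_sum (V_field X) (C_cst 0) _ C_add Cfk).
by apply: eq_bigr => i _; rewrite (vf_leibniz (V_field X))//; exact: V_mem.
Qed.

Lemma r_bivector_field : is_bivector_field C P.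
Proof.
split=> [f k Cf Ck|f Cf]; first by apply/funext => m; exact: r_bivector_skew.
split=> [k Ck|a k l Ck Cl|k l Ck Cl]; first exact: r_bivector_mem.
- apply/funext => m; rewrite /P mulrN mulr_sumr -opprD -big_split/=.
  congr (- _); apply: eq_bigr => i _.
  by rewrite (vf_linear (V_field _) a Ck Cl) mulrDr mulrCA.
- apply/funext => m; rewrite /P mulNr mulrN mulr_suml mulr_sumr -opprD -big_split/=.
  congr (- _); apply: eq_bigr => i _.
  by rewrite (vf_leibniz (V_field _) Ck Cl); ring.
Qed.

(** The derivative acts through the brackets [X, e_i] and [X, t_i]. The mixed e, t terms cancel,
    leaving the e components of [X, t_i], whose coefficients are B([t_i, t_j], X) by invariance. *)
Lemma lie_derivative_r_bivector X f k m :
  C f -> C k -> (forall i j, B (brk X (e i)) (e j) = 0) ->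
  lie_derivative (V X) P f k m =
  - \sum_i \sum_j B (brk (t i) (t j)) X * V (e i) f m * V (e j) k m.
Proof.
move=> Cf Ck gX; rewrite /lie_derivative V_r_bivector// /P -!opprD -!sumrB.
have -> : \sum_i (V X (V (e i) f) m * V (t i) k m + V (e i) f m * V X (V (t i) k) m
     - V (e i) (V X f) m * V (t i) k m - V (e i) f m * V (t i) (V X k) m) =
  \sum_i (V (brk X (e i)) f m * V (t i) k m + V (e i) f m * V (brk X (t i)) k m).
  by apply: eq_bigr => i _; rewrite !V_bracket//; ring.
congr (- _).
rewrite big_split/=.
(* Invariance gives B([X, e_i], t_j) = - B([X, t_j], e_i), so this sum is opposite to the one from
   the t components of [X, t_i]. *)
have -> : \sum_i V (brk X (e i)) f m * V (t i) k m =
    \sum_i \sum_j - (B (brk X (t i)) (e j) * V (e i) f m * V (t j) k m).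
  rewrite exchange_big/=; apply: eq_bigr => i _.
  rewrite (V_expansion (brk X (e i)) m Cf) [X in _ + X]big1 ?addr0; last first.
    by move=> j _; rewrite gX mul0r.
  rewrite mulr_suml; apply: eq_bigr => j _.
  rewrite brkC linearNl/= B_invariant (symmetricC B (e i)).
  by rewrite !mulNr.
rewrite -big_split/=; apply: eq_bigr => i _.
rewrite (V_expansion (brk X (t i)) m Ck) mulrDr !mulr_sumr addrCA.
rewrite -big_split/= [X in _ + X]big1 ?addr0.
  apply: eq_bigr => j _.
  by rewrite (symmetricC B (brk (t i) _)) -B_invariant; ring.
by move=> j _; ring.
Qed.

(** Skewness first arranges that the innermost field is always some e on f and some t on l. The
    second order terms in k and in l then pair into commutators; those in f do so after using
    coisotropy. *)
Lemma jacobiator_r_bivector f k l m : C f -> C k -> C l ->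
  P f (P k l) m + P k (P l f) m + P l (P f k) m =
  \sum_i \sum_j \sum_p B (brk (t i) (t j)) (t p) *
    V (e i) f m * V (e j) k m * V (e p) l m.
Proof.
move=> Cf Ck Cl.
have Pmem := r_bivector_mem.
have E1 : P f (P k l) m = \sum_i \sum_j
    (V (e i) f m * V (t i) (V (e j) k) m * V (t j) l m +
     V (e i) f m * V (e j) k m * V (t i) (V (t j) l) m).
  rewrite {1}/P -sumrN; apply: eq_bigr => i _.
  rewrite V_r_bivector// mulrN opprK mulr_sumr; apply: eq_bigr => j _; ring.
have E2 : P k (P l f) m = - \sum_i \sum_j
    (V (e i) k m * V (t i) (V (e j) f) m * V (t j) l m +
     V (e j) f m * V (e i) k m * V (t i) (V (t j) l) m).
  rewrite (_ : P l f = fun m => - P f l m); last first.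
    by apply/funext => m'; rewrite r_bivector_skew.
  have [_ dP] := r_bivector_field.
  rewrite (vector_fieldN (dP k Ck) (C_cst 0))//; last exact: Pmem.
  congr (- _).
  rewrite {1}/P -sumrN; apply: eq_bigr => i _.
  rewrite V_r_bivector// mulrN opprK mulr_sumr; apply: eq_bigr => j _; ring.
have E3 : P l (P f k) m = - \sum_i \sum_j
    (V (e j) (V (e i) f) m * V (t i) k m * V (t j) l m +
     V (e i) f m * V (e j) (V (t i) k) m * V (t j) l m).
  rewrite r_bivector_skew//; last exact: Pmem.
  congr (- _); rewrite exchange_big {1}/P -sumrN; apply: eq_bigr => j _.
  rewrite V_r_bivector// mulNr opprK mulr_suml; apply: eq_bigr => i _; ring.
have E4 : \sum_i \sum_j (V (e i) k m * V (t i) (V (e j) f) m * V (t j) l m +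
       V (e j) (V (e i) f) m * V (t i) k m * V (t j) l m) =
    \sum_i \sum_j V (brk (e j) (e i)) f m * V (t i) k m * V (t j) l m.
  rewrite exchange_big [RHS]exchange_big/=; apply: eq_bigr => j _.
  under eq_bigr do rewrite -mulrDl.
  rewrite -!mulr_suml; congr (_ * _).
  (* coisotropy for V (e j) f and k removes the second order terms *)
  have K := V_coisotropic m (V_mem (e j) Cf) Ck.
  apply/eqP; rewrite -subr_eq0 -sumrB -[X in _ == X]K; apply/eqP.
  by apply: eq_bigr => i _; rewrite V_bracket//; ring.
(* Renaming the indices in the second sum of [E2] matches the second order terms in l of [E1]. *)
have E2' : P k (P l f) m = - (\sum_i \sum_j
      V (e i) k m * V (t i) (V (e j) f) m * V (t j) l m +
    \sum_i \sum_j V (e i) f m * V (e j) k m * V (t j) (V (t i) l) m).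
  rewrite E2; congr (- _); rewrite [X in _ = _ + X]exchange_big -big_split/=.
  by apply: eq_bigr => i _; rewrite -big_split.
have -> : P f (P k l) m + P k (P l f) m + P l (P f k) m =
    \sum_i \sum_j V (e i) f m * V (brk (t i) (e j)) k m * V (t j) l m
  + \sum_i \sum_j V (e i) f m * V (e j) k m * V (brk (t i) (t j)) l m
  - \sum_i \sum_j V (brk (e j) (e i)) f m * V (t i) k m * V (t j) l m.
  rewrite -E4 E1 E2' E3 -!sumrN -!big_split -sumrN -!big_split/=.
  apply: eq_bigr => i _; rewrite -!sumrN -!big_split -!sumrN -!big_split/=.
  by apply: eq_bigr => j _; rewrite !V_bracket//; ring.
(* Invariance gives B([t_i, e_j], t_p) = - B([t_i, t_p], e_j) and B([t_i, e_j], e_p) = B([e_j, e_p],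
   t_i); the two sums cancel against parts of [T2] and [T3]. *)
have T1 : \sum_i \sum_j V (e i) f m * V (brk (t i) (e j)) k m * V (t j) l m =
  - (\sum_i \sum_j \sum_p B (brk (t i) (t j)) (e p) *
      V (e i) f m * V (e j) k m * V (t p) l m)
  + \sum_i \sum_j \sum_p B (brk (e j) (e i)) (t p) *
      V (e p) f m * V (t i) k m * V (t j) l m.
  rewrite [X in _ = _ + X]exchange_big/=.
  under [X in _ = _ + X]eq_bigr do rewrite exchange_big/=.
  rewrite [X in _ = _ + X]exchange_big/= -sumrN -big_split/=.
  apply: eq_bigr => i _; rewrite [X in _ = - X + _]exchange_big/= -sumrN -big_split/=.
  apply: eq_bigr => j _; rewrite (V_expansion (brk (t i) (e j)) m Ck) mulrDr mulrDl.
  rewrite !mulr_sumr !mulr_suml.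
  rewrite -sumrN; congr (_ + _); apply: eq_bigr => p _.
    rewrite (brkC _ (e j)) linearNl/= B_invariant (symmetricC B (e j)); ring.
  by rewrite B_invariant (symmetricC B (t i)); ring.
have T2 : \sum_i \sum_j V (e i) f m * V (e j) k m * V (brk (t i) (t j)) l m =
  \sum_i \sum_j \sum_p B (brk (t i) (t j)) (t p) *
      V (e i) f m * V (e j) k m * V (e p) l m
  + \sum_i \sum_j \sum_p B (brk (t i) (t j)) (e p) *
      V (e i) f m * V (e j) k m * V (t p) l m.
  rewrite -big_split/=; apply: eq_bigr => i _; rewrite -big_split/=.
  apply: eq_bigr => j _; rewrite (V_expansion (brk (t i) (t j)) m Cl) mulrDr !mulr_sumr.
  by congr (_ + _); apply: eq_bigr => p _; ring.
have T3 : \sum_i \sum_j V (brk (e j) (e i)) f m * V (t i) k m * V (t j) l m =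
  \sum_i \sum_j \sum_p B (brk (e j) (e i)) (t p) *
      V (e p) f m * V (t i) k m * V (t j) l m.
  apply: eq_bigr => i _; apply: eq_bigr => j _; rewrite (V_expansion (brk (e j) (e i)) m Cf).
  rewrite [X in _ + X]big1 ?addr0 => [|p _]; last by rewrite e_closed mul0r.
  by rewrite !mulr_suml.
by rewrite T1 T2 T3; ring.
Qed.

End QuasiPoissonAlgebra.

(** * The dressing action *)

Section CosetSpace.
Context {R : realType} {n : nat} {D : lieGroupType R n.*2} {L : lieAlgebra D}.
Context {G : set D}.
Hypothesis G_mul : forall x y, G x -> G y -> G (x * y)%g.
Hypothesis G_inv : forall x, G x -> G (x^-1)%g.
Local Notation S := (coset_space G).
Local Notation C := (smooth_functions_quotient G).
Local Notation V := (fundamental_field (L := L) (dressing G)).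
Implicit Types (f k : S -> R) (X Y : L) (d : D) (s : S).

Lemma coset_reprK s : coset_proj G (coset_repr s) = s.
Proof.
apply: eq_sig_hprop => [A|/=]; first exact: Prop_irrelevance.
exact/esym/(projT2 (cid (svalP s))).
Qed.

Lemma coset_projM d x : G x -> coset_proj G (d * x)%g = coset_proj G d.
Proof.
move=> Gx; apply: eq_sig_hprop => [A|/=]; first exact: Prop_irrelevance.
apply/seteqP; split=> _ [y Gy <-].
  by exists (x * y)%g; [exact: G_mul|rewrite mulgA].
exists (x^-1 * y)%g; first by apply: G_mul => //; exact: G_inv.
by rewrite -mulgA mulVKg.
Qed.

Lemma dressing_proj a d : dressing G a (coset_proj G d) = coset_proj G (a * d)%g.
Proof.
apply: eq_sig_hprop => [A|/=]; first exact: Prop_irrelevance.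
apply/seteqP; split=> [_ [_ [x Gx <-] <-]|_ [x Gx <-]].
  by exists x => //; rewrite mulgA.
by exists (d * x)%g; [exists x|rewrite mulgA].
Qed.

Lemma coset_funext (T : Type) (u v : S -> T) :
  (forall d, u (coset_proj G d) = v (coset_proj G d)) -> u = v.
Proof. by move=> uv; apply/funext => s; rewrite -(coset_reprK s). Qed.

Lemma quotient_cst (c : R) : C (fun=> c).
Proof. exact: smooth_functions_cst. Qed.

Lemma quotientD f k : C f -> C k -> C (fun s => f s + k s).
Proof. exact: smooth_functionsD. Qed.

Lemma quotientM f k : C f -> C k -> C (fun s => f s * k s).
Proof. exact: smooth_functionsM. Qed.

Lemma fundamental_field_proj X f d : C f ->
  V X f (coset_proj G d) = - rho X (f \o coset_proj G) d.
Proof.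
move=> Cf; rewrite /fundamental_field derive1E.
pose u (t : R) := f (coset_proj G (expo (t *: X) * d)%g).
rewrite (_ : (fun t => _) = u \o -%R); last first.
  by apply/funext => t; rewrite dressing_proj.
have sf := smooth_functions_mulr d Cf.
(* The base point - 0 is the value at 0 of t |-> - t, with which u is composed. *)
have du : is_derive (- 0 : R) 1 u (rho X (f \o coset_proj G) d).
  have := expo_flow X (- 0) sf.
  by rewrite oppr0 scale0r expo0.
have [_ ->] := is_derive1_comp du (is_deriveNid (0 : R) 1).
by rewrite mulrN1.
Qed.

Lemma fundamental_field_mem X f : C f -> C (V X f).
Proof.
move=> Cf; rewrite /smooth_functions_quotient /=.
have := smooth_functionsZ (-1) (vf_smooth (rho_vector_field X) Cf).
congr (smooth_functions D _); apply/funext => d /=.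
by rewrite fundamental_field_proj// mulN1r.
Qed.

Lemma fundamental_field_vector_field X : is_vector_field C (V X).
Proof.
have rX := rho_vector_field X; split=> [|a f k Cf Ck|f k Cf Ck].
- exact: fundamental_field_mem.
- apply: coset_funext => d; rewrite !fundamental_field_proj//; last first.
    by apply: quotientD => //; apply: quotientM => //; exact: quotient_cst.
  rewrite (_ : _ \o _ = fun d => a * (f \o coset_proj G) d + (k \o coset_proj G) d)//.
  by rewrite (vf_linear rX a Cf Ck) mulrN opprD.
- apply: coset_funext => d; rewrite !fundamental_field_proj//; last first.
    exact: quotientM.
  rewrite (_ : _ \o _ = fun d => (f \o coset_proj G) d * (k \o coset_proj G) d)//.
  by rewrite (vf_leibniz rX Cf Ck) mulNr mulrN opprD.
Qed.

(** The sign in the lift - X^rho compensates the reversed order in [rho_bracket]. *)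
Lemma fundamental_field_bracket X Y f s : C f ->
  V (bracket X Y) f s = V X (V Y f) s - V Y (V X f) s.
Proof.
move=> Cf; rewrite -(coset_reprK s); move: (coset_repr s) => d.
have VV U W : V U (V W f) (coset_proj G d) = rho U (rho W (f \o coset_proj G)) d.
  rewrite fundamental_field_proj; last exact: fundamental_field_mem.
  rewrite (_ : _ \o _ = fun d => - rho W (f \o coset_proj G) d); last first.
    by apply/funext => x /=; rewrite fundamental_field_proj.
  rewrite (vector_fieldN (rho_vector_field U) (smooth_functions_cst 0)) ?opprK//.
  exact: (vf_smooth (rho_vector_field W) Cf).
by rewrite !VV fundamental_field_proj// rho_bracket// opprB.
Qed.

End CosetSpace.

(** * Coisotropy and the projection of P_D to D/G *)

Section QuasiTriples.
Context {R : realType} {n : nat} {D : lieGroupType R n.*2} {L : lieAlgebra D}.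
Context {B : {symmetric L}} {G : set D} {g h : {vspace L}}.
Context {e : (\dim g).-tuple L}.
Hypothesis DGh : is_quasi_triple B G g h.
Hypothesis e_basis : basis_of g e.
Local Notation C := (smooth_functions_quotient G).
Local Notation V := (fundamental_field (L := L) (dressing G)).
Local Notation jdual := (fun i => j B h (dual_basis e i)).

Let gp : is_group_pair B G g := quasi_triple_group_pair DGh.
Let mp : is_manin_pair B g := group_manin_pair gp.
Let G_mul := subgroup_mul gp.
Let G_inv := subgroup_inv gp.
Let expansion := hyperbolic_expansion (manin_nondegenerate mp)
  (manin_isotropic mp) (quasi_triple_isotropic DGh) (quasi_triple_sum DGh) e_basis.

Lemma is_Ad_sym d (X Y : L) : is_Ad d X Y -> is_Ad (d^-1)%g Y X.
Proof.
move=> XY f sf; have sfd : smooth_functions D (fun y => f (d^-1 * y * d)%g).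
  have := smooth_functions_mulr d (smooth_functions_mull (d^-1)%g sf).
  by congr (smooth_functions D _); apply/funext => y; rewrite mulgA.
rewrite invgK (XY _ sfd); congr (lambda X _ _); apply/funext => y.
by rewrite !mulgA mulVg mul1g mulgVK.
Qed.

Lemma functional_expansion (phi : L -> R^o) Y : linear phi ->
  phi Y = \sum_i B Y (jdual i) * phi (tnth e i)
        + \sum_i B Y (tnth e i) * phi (jdual i).
Proof.
move=> lphi; rewrite -(linfunE lphi) {1}(expansion Y) linearD !linear_sum/=.
by congr (_ + _); apply: eq_bigr => i _; rewrite linearZ/= linfunE.
Qed.

Lemma fundamental_field_expansion Z f s : C f ->
  V Z f s = \sum_i B Z (jdual i) * V (tnth e i) f s
          + \sum_i B Z (tnth e i) * V (jdual i) f s.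
Proof.
move=> Cf; rewrite -(coset_reprK s); move: (coset_repr s) => d.
have lV : linear (fun X => V X f (coset_proj G d) : R^o).
  move=> a X Y; rewrite !fundamental_field_proj// rho_linear//.
  by rewrite opprD -mulrN.
exact: (functional_expansion Z lV).
Qed.

Lemma lambda_quotient X f d : X \in g -> C f ->
  lambda X (f \o coset_proj G) d = 0.
Proof.
move=> Xg Cf; apply: (lambda_right_invariant (G := G)) => //.
  exact/(subgroup_lie_algebra gp).
by move=> y x Gx /=; rewrite coset_projM.
Qed.

(* The covector X |-> (X_S f)(s) corresponds under B to an element of
   Ad_d g, where s = d G; this subspace is isotropic as Ad_d preserves B. *)
Lemma fundamental_field_coisotropic f k s : C f -> C k ->
  \sum_i (V (tnth e i) f s * V (jdual i) k s +
          V (jdual i) f s * V (tnth e i) k s) = 0.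
Proof.
move=> Cf Ck; rewrite -(coset_reprK s); move: (coset_repr s) => d.
pose phi f (X : L) : R^o := rho X (f \o coset_proj G) d.
have lphi f' : C f' -> linear (phi f').
  by move=> Cf' a X Y; rewrite /phi rho_linear.
(* The vector representing the functional [phi f] under B; the coefficients are crossed because the
   two families are dual to each other. *)
pose m f := \sum_i phi f (jdual i) *: tnth e i + \sum_i phi f (tnth e i) *: jdual i.
have Bm f' X : C f' -> B X (m f') = phi f' X.
  move=> Cf'; rewrite (functional_expansion X (lphi _ Cf')) linearDr/= !linear_sumr/=.
  rewrite addrC; congr (_ + _); apply: eq_bigr => i _;
  by rewrite linearZr/= mulrC.
(* For x in g the right-invariant field of Ad_d x agrees at d with x^lambda, which kills pulled-back
   functions. Hence Ad_(d^-1) of [m f'] is orthogonal to g, so it lies in g. *)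
have Adm f' : C f' -> exists2 Y, is_Ad (d^-1)%g (m f') Y & Y \in g.
  move=> Cf'; have [Y mY] := exists_Ad (d^-1)%g (m f'); exists Y => //.
  apply: (isotropic_orthogonal (manin_nondegenerate mp) (manin_isotropic mp)
    (quasi_triple_isotropic DGh) (quasi_triple_sum DGh) e_basis) => x xg.
  have [x' xx'] := exists_Ad d x; have x'x := is_Ad_sym xx'.
  rewrite (group_biinvariant gp mY x'x) symmetricC Bm//.
  by rewrite /phi (rho_Ad x'x Cf') lambda_quotient.
have [Yf mYf Yfg] := Adm f Cf; have [Yk mYk Ykg] := Adm k Ck.
have : B (m f) (m k) = 0.
  by rewrite -(group_biinvariant gp mYf mYk); exact: (manin_isotropic mp).
rewrite Bm// (functional_expansion (m f) (lphi _ Ck)).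
rewrite -big_split/= => K; rewrite -[RHS]K; apply: eq_bigr => i _.
by rewrite !fundamental_field_proj// !mulrNN !(symmetricC B (m f)) !Bm// addrC.
Qed.

Local Notation P := (proj_bivector (G := G) (P_D B h e)).
Local Notation Q := (r_bivector (e := fun i => tnth e i) (t := jdual) (V := V)).

(** The left-invariant part is killed by its first factors e_i, which lie in g; in the
    right-invariant part the two signs of the lifts cancel. *)
Lemma P_D_quotient f k d : C f -> C k ->
  P_D B h e (f \o coset_proj G) (k \o coset_proj G) d = Q f k (coset_proj G d).
Proof.
move=> Cf Ck; rewrite /P_D big1 ?sub0r => [|i _].
  congr (- _); apply: eq_bigr => i _.
  by rewrite !fundamental_field_proj// mulrNN.
by rewrite lambda_quotient ?mul0r// tnth_basis_mem.
Qed.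

Lemma proj_P_D f k : C f -> C k -> P f k = Q f k.
Proof.
move=> Cf Ck; apply/funext => s.
by rewrite /proj_bivector P_D_quotient// coset_reprK.
Qed.

End QuasiTriples.

Unset Implicit Arguments.

Theorem mainTheorem4 (R : realType) (n : nat) (D : lieGroupType R n.*2)
    (L : lieAlgebra D) (B : {symmetric L}) (G : set D) (g h : {vspace L})
    (DGh : is_quasi_triple B G g h)
    (e : (\dim g).-tuple L) (e_basis : basis_of g e) :
  projects_to (P_D B h e) (proj_bivector (G := G) (P_D B h e)) /\
  is_quasi_poisson_action h (dressing G) e B (smooth_functions_quotient G)
    (proj_bivector (P_D B h e)).
Proof.
have gp := quasi_triple_group_pair DGh.
have mp := group_manin_pair gp.
have G_mul := subgroup_mul gp; have G_inv := subgroup_inv gp.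
have ndg := manin_nondegenerate mp; have isog := manin_isotropic mp.
have isoh := quasi_triple_isotropic DGh; have sum := quasi_triple_sum DGh.
have direct := quasi_triple_direct DGh.
have eg := tnth_basis_mem e_basis.
have PQ := proj_P_D DGh e_basis.
pose V (X : L) := fundamental_field (dressing G) X.
pose C := smooth_functions_quotient G.
have VC X : is_vector_field C (V X).
  exact: fundamental_field_vector_field.
have Vbr X Y f s : C f -> V (bracket X Y) f s = V X (V Y f) s - V Y (V X f) s.
  exact: fundamental_field_bracket.
have Vexp Z f s (Cf : C f) := fundamental_field_expansion DGh e_basis Z s Cf.
have Vco f k s (Cf : C f) (Ck : C k) :=
  fundamental_field_coisotropic DGh e_basis s Cf Ck.
have Qmem := r_bivector_mem quotient_cst quotientD quotientM VC.
have Qfield := r_bivector_field quotient_cst quotientD quotientM VC Vco.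
have e_closed i k l : B (bracket (tnth e i) (tnth e k)) (tnth e l) = 0.
  by apply: isog => //; apply: (manin_subalgebra mp).
split.
  (* Both sides are the value of the fixed expression [r_bivector] at the class of d, so the chosen
     representative is immaterial. *)
  move=> f k Cf Ck; apply/funext => d; rewrite /= PQ//.
  by rewrite (P_D_quotient DGh e_basis).
split.
- split=> [f k Cf Ck|f Cf]; first by rewrite !PQ// (bv_skew Qfield).
  have [Qm Ql QL] := bv_derivation Qfield Cf.
  split=> [k Ck|a k l Ck Cl|k l Ck Cl].
  + by rewrite PQ//; exact: Qm.
  + rewrite !PQ//; first exact: Ql.
    by apply: quotientD => //; apply: quotientM => //; exact: quotient_cst.
  + by rewrite !PQ//; [exact: QL|exact: quotientM].
- move=> f k l Cf Ck Cl s; rewrite /schouten_square mulrA mulVf ?pnatr_eq0// mul1r.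
  (* The inner brackets are replaced first; their smoothness, given by [Qmem], then allows replacing
     the outer ones. *)
  rewrite !(PQ k l, PQ l f, PQ f k)// !PQ//; try exact: Qmem.
  rewrite (jacobiator_r_bivector quotient_cst quotientD quotientM VC Vbr Vexp Vco
    (@bracketC _ _ _ L) (manin_invariant mp) e_closed)//.
  apply: eq_bigr => i _; apply: eq_bigr => i' _; apply: eq_bigr => i'' _.
  by rewrite (phi_tensorE ndg isog isoh direct sum)//.
- move=> x f k Cf Ck s.
  have Cx u : C u -> C (V (vsval x) u) by move=> Cu; exact: (vf_smooth (VC _) Cu).
  rewrite /lie_derivative !PQ//; try exact: Cx.
  have := lie_derivative_r_bivector quotient_cst quotientD quotientM VC Vbr Vexp
    (@bracketC _ _ _ L) (manin_invariant mp) (X := vsval x) s Cf Ck.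
  rewrite /lie_derivative => ->.
    congr (- _); apply: eq_bigr => i _; apply: eq_bigr => i' _.
    by rewrite (F_tensorE isog direct sum).
  (* For x in g the bracket [x, e_i] stays in g, hence is orthogonal to every e_j. *)
  move=> i k'; apply: isog => //; apply: (manin_subalgebra mp) => //.
  exact: subvsP.
Qed.
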